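(* Let $f:\Omega\to\mathbb{R}$ be a continuous potential satisfying the weak Walters condition, and consider $\mathscr{L}_f:C(\Omega)\to C(\Omega)$. Then there exist a real number $\lambda_f>0$, a strictly positive continuous function $h_f$, and a unique Borel probability measure $\nu_f$ such that (i) $\mathscr{L}_fh_f=\lambda_fh_f$ and $\mathscr{L}_f^*\nu_f=\lambda_f\nu_f$; (ii) for every $\varphi\in C(\Omega)$, $\big\|\lambda_f^{-n}\mathscr{L}_f^n\varphi-h_f\int_\Omega\varphi\,d\nu_f\big\|_0\to0$ as $n\to\infty$.
   Context: $(M,d)$ is a compact metric space and $\mu$ is a Borel probability measure on $M$ with $\operatorname{supp}\mu=M$. $\Omega=M^{\mathbb{N}}$ with metric $d_\Omega(x,y)=\sum_{n\ge1}2^{-n}d(x_n,y_n)$, $\sigma$ the left shift, $ax=(a,x_1,\dots)$ and $\mathbf{a}x=(a_1,\dots,a_n,x_1,\dots)$ for $\mathbf{a}\in M^n$. The Ruelle operator is $\mathscr{L}_f(\varphi)(x)=\int_M e^{f(ax)}\varphi(ax)\,d\mu(a)$ and $\mathscr{L}_f^*$ is its dual on Borel measures. $\|\cdot\|_0$ is the sup norm. $S_nf=\sum_{i=0}^{n-1}f\circ\sigma^i$; $C_f(x,y)=\sup_{n\ge1}\sup_{\mathbf{a}\in M^n}(S_nf(\mathbf{a}x)-S_nf(\mathbf{a}y))$; $f$ satisfies the weak Walters condition if $C_f(x,y)\to0$ as $d_\Omega(x,y)\to0$. *)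

(* Defs.v *)
From HB Require Import structures.
From mathcomp Require Import all_boot all_order all_algebra.
From mathcomp Require Import all_classical all_reals all_analysis.
Set Implicit Arguments. Unset Strict Implicit. Unset Printing Implicit Defensive.
Import Order.TTheory GRing.Theory Num.Theory.
Import numFieldNormedType.Exports.
Local Open Scope classical_set_scope.
Local Open Scope ring_scope.

Section Defs.
Variables (R : realType) (M : pointedType).

Definition is_metric (d : M -> M -> R) : Prop :=
  [/\ forall x y, 0 <= d x y,
      forall x y, d x y = 0 <-> x = y,
      forall x y, d x y = d y x &
      forall x y z, d x z <= d x y + d y z].

Definition mopen {T : Type} (dT : T -> T -> R) (U : set T) : Prop :=
  forall x, U x -> exists2 r : R, 0 < r & forall y, dT x y < r -> U y.

Definition mcompact (d : M -> M -> R) : Prop :=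
  forall (I : Type) (U : I -> set M),
    (forall i, mopen d (U i)) -> (forall x, exists i, U i x) ->
    exists (n : nat) (g : 'I_n -> I), forall x, exists k, U (g k) x.

Definition mcontinuous {T : Type} (dT : T -> T -> R) (g : T -> R) : Prop :=
  forall x (e : R), 0 < e -> exists2 del : R, 0 < del &
    forall y, dT x y < del -> `|g x - g y| < e.

(* Omega = M^N (indexed from 0 here), d_Omega(x,y) = sum_{n>=0} 2^{-(n+1)} d(x_n,y_n) *)
Definition dOmega (d : M -> M -> R) (x y : nat -> M) : R :=
  limn (fun N : nat => \sum_(0 <= n < N) ((2 ^- n.+1) * d (x n) (y n))).

Definition pcons (a : M) (x : nat -> M) : nat -> M :=
  fun k => if k is k'.+1 then x k' else a.

(* (a_1..a_n) x ; the word is given by the first n values of w *)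
Definition pword (n : nat) (w : nat -> M) (x : nat -> M) : nat -> M :=
  fun k => if (k < n)%N then w k else x (k - n)%N.

Definition shift (x : nat -> M) : nat -> M := fun k => x k.+1.

Definition Ssum (f : (nat -> M) -> R) (n : nat) (x : nat -> M) : R :=
  \sum_(i < n) f (iter i shift x).

Definition Cf (f : (nat -> M) -> R) (x y : nat -> M) : \bar R :=
  ereal_sup [set r : \bar R | exists (n : nat) (w : nat -> M), (0 < n)%N /\
               r = ((Ssum f n (pword n w x) - Ssum f n (pword n w y))%:E)].

Definition weak_walters (d : M -> M -> R) (f : (nat -> M) -> R) : Prop :=
  forall e : R, 0 < e -> exists2 del : R, 0 < del &
    forall x y, dOmega d x y < del -> (`|Cf f x y| < e%:E)%E.

Definition ruelle (d : M -> M -> R)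
  (mu : {measure set (g_sigma_algebraType (mopen d)) -> \bar R})
  (f : (nat -> M) -> R) (phi : (nat -> M) -> R) (x : nat -> M) : R :=
  Rintegral mu setT (fun a : g_sigma_algebraType (mopen d) =>
     expR (f (pcons a x)) * phi (pcons a x)).

Definition sup_norm (g : (nat -> M) -> R) : \bar R :=
  ereal_sup (range (fun x => (`|g x|)%:E)).

End Defs.

(* Main.v *)
(* The ratios [L^n g / L^n 1] of iterates of a positive operator [L] control its
   asymptotics. The weak Walters condition, compared along each inverse branch,
   makes the logarithms of the iterates [L^n g] of a positive function
   equicontinuous; full support of [mu] means that a power of [L] turns a lower
   bound on one ball into a lower bound everywhere. Together they force the
   ratios into intervals that shrink geometrically, at a rate depending on [g]
   only through its oscillation and a modulus of continuity common to all its
   ratios. The limit of the ratios of [g] is thus a number, positive and linear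
   in [g], hence the integral of [g] for a probability measure [nu] by Riesz
   representation, and [L^* nu = lam nu] with [lam := nu(L 1)]. Uniformity over
   the functions [lam^-m L^m 1], which are bounded above and below by Harnack's
   inequality, makes [lam^-n L^n 1] a uniform Cauchy sequence; its limit is [h],
   and [lam^-n L^n g] is the product of this sequence by the ratio of [g]. *)

Require Import Defs.
From HB Require Import structures.
From mathcomp Require Import all_boot all_order all_algebra finmap.
From mathcomp Require Import all_classical all_reals all_analysis.
From mathcomp Require Import measurable_realfun lra ring.
Import Order.TTheory GRing.Theory Num.Theory.
Import numFieldNormedType.Exports.
Local Open Scope classical_set_scope.
Local Open Scope ring_scope.
Set Implicit Arguments.
Unset Strict Implicit.
Unset Printing Implicit Defensive.

(** * Metric spaces as types *)

#[short(type="pmetricType")]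
HB.structure Definition PointedMetric (K : numDomainType) :=
  {T of Pointed T & Metric K T}.

Section Metrized.
Variables (R : realType) (T : pointedType) (d : T -> T -> R).

Definition metrized (dm : is_metric d) : Type := T.

Variable dm : is_metric d.
Local Notation X := (metrized dm).

Let d_refl (x : X) : d x x = 0.
Proof. by have [_ d0 _ _] := dm; exact: (d0 x x).2. Qed.

Let d_positivity (x y : X) : d x y = 0 -> x = y.
Proof. by have [_ d0 _ _] := dm; exact: (d0 x y).1. Qed.

Let d_sym (x y : X) : d x y = d y x.
Proof. by have [_ _ ds _] := dm; exact: ds. Qed.

Let d_triangle (y x z : X) : d x z <= d x y + d y z.
Proof. by have [_ _ _ dt] := dm; exact: dt. Qed.

HB.instance Definition _ := Pointed.copy X T.
HB.instance Definition _ :=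
  isMetric.Build R X d_refl d_positivity d_sym d_triangle.

End Metrized.

Section MetrizedTheory.
Variables (R : realType) (T : pointedType) (d : T -> T -> R) (dm : is_metric d).
Local Notation X := (metrized dm).

Lemma mopenE : mopen d = (@open X : set (set T)).
Proof.
apply/seteqP; split=> U; rewrite openE => Uo x Ux.
  by have [r r0 rU] := Uo x Ux; apply/nbhs_ballP; exists r.
by have /nbhs_ballP[r r0 rU] := Uo x Ux; exists r.
Qed.

Lemma mcontinuousP (g : T -> R) : mcontinuous d g <-> continuous (g : X -> R).
Proof.
split=> [gc x|gc x e e0].
  apply/(@cvgrPdist_lt _ _ _ (nbhs (x : X))) => e e0.
  by have [r r0 gr] := gc x e e0; apply/nbhs_ballP; exists r.
have /(@cvgrPdist_lt _ _ _ (nbhs (x : X)))/(_ e e0)/nbhs_ballP[r r0 gr] := gc x.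
by exists r.
Qed.

Lemma mcompact_compact : mcompact d -> compact [set: X].
Proof.
move=> dc; rewrite compact_cover => J D U Uo UT.
pose V (j : {j | D j}) : set T := U (sval j).
have [j|x|n [g gT]] := dc _ V; first by rewrite mopenE; exact: Uo (svalP j).
  by have [j Dj Ujx] := UT x I; exists (exist _ j Dj).
exists [fset sval (g k) | k in 'I_n]%fset.
  by move=> _ /imfsetP[k _ ->]; rewrite inE; exact: (svalP (g k)).
by move=> x _; have [k gkx] := gT x; exists (sval (g k)) => //;
  exact: in_imfset.
Qed.

End MetrizedTheory.

(** * Compactness *)

Section Compactness.
Variables (R : realType) (X : topologicalType).
Hypothesis Xc : compact [set: X].
Implicit Type g : X -> R.

Lemma compact_near_forall I (F : set_system I) (P : I -> X -> Prop) :
  Filter F -> (forall x : X, \forall y \near x & i \near F, P i y) ->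
  \forall i \near F, forall x, P i x.
Proof.
move=> FF FP; have /compact_near_coveringP Xnc := Xc.
by apply: filterS (Xnc _ _ _ FF (fun x _ => FP x)) => i Pi x; exact: Pi.
Qed.

Lemma compact_continuous_bounded g : continuous g ->
  exists2 C : R, 0 < C & forall x, `|g x| <= C.
Proof.
move=> gc.
have gC : \forall C \near +oo, forall x, `|g x| <= C.
  apply: compact_near_forall => x; near=> y C => /=.
  apply: (@le_trans _ _ (`|g x| + 1)); last by near: C; exact: nbhs_pinfty_ge.
  rewrite -lerBlDl (le_trans (lerB_dist _ _))// distrC ltW//; near: y.
  by move/cvgrPdist_lt: (gc x); apply.
near (pinfty_nbhs R) => C; exists C; first by near: C; exact: nbhs_pinfty_gt.
by near: C.
Unshelve. all: by end_near. Qed.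

Lemma compact_continuous_gt0 g : continuous g -> (forall x, 0 < g x) ->
  exists2 c : R, 0 < c & forall x, c <= g x.
Proof.
move=> gc g0.
have gge : \forall c \near 0^'+, forall x, c <= g x.
  apply: compact_near_forall => x; near=> y c => /=.
  apply: (@le_trans _ _ (g x / 2)).
    by near: c; apply: nbhs_right_le; rewrite divr_gt0.
  by apply: ltW; near: y; apply: cvgr_gt (gc x) _ _;
    rewrite gtr_pMr// invf_lt1 ?ltr1n.
near (0 : R)^'+ => c; exists c; first by near: c; exact: nbhs_right_gt.
by near: c.
Unshelve. all: by end_near. Qed.

Lemma dini (F : nat -> X -> R) g : continuous g ->
  (forall n, continuous (F n)) -> (forall x, nondecreasing_seq (F ^~ x)) ->
  (forall x (e : R), 0 < e -> exists n, g x < F n x + e) ->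
  forall e : R, 0 < e -> \forall n \near \oo, forall x, g x < F n x + e.
Proof.
move=> gc Fc Fnd gF e e0; apply: compact_near_forall => x.
have [N gN] := gF x e e0; near=> y n => /=.
apply: (@lt_le_trans _ _ (F N y + e)); last first.
  by rewrite lerD2r; apply: Fnd; near: n; exact: nbhs_infty_ge.
rewrite -ltrBlDl; near: y.
by apply: cvgr_lt (cvgB (gc x) (Fc N x)) _ _; rewrite ltrBlDl.
Unshelve. all: by end_near. Qed.

End Compactness.

Lemma open_superlevel (R : realType) (X : topologicalType) (g : X -> R)
    (c : R) : continuous g -> open [set x | c < g x].
Proof.
move=> gc; apply: (@open_comp _ _ g [set r | c < r]) => [x _|]; first exact: gc.
exact: open_gt.
Qed.

Lemma compact_unif_continuous (R : realType) (X V : pseudoMetricType R)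
    (g : X -> V) : compact [set: X] -> continuous g -> unif_continuous g.
Proof.
move=> Xc gc; apply/unif_continuousP => e e0.
have gr : \forall r \near (0 : R)^'+, forall x y, ball x r y ->
  ball (g x) e (g y).
  apply: (compact_near_forall Xc) => x.
  have [|s s0 gs] := (nbhs_ballP x _).1 (gc x (ball (g x) (e / 2)) _).
    by apply: nbhsx_ballx; rewrite divr_gt0.
  near=> y r => /= z yz; rewrite [e]splitr.
  apply: (@ball_triangle _ _ (g x)); first apply/ball_sym.
    apply: gs; near: y; apply: nbhsx_ballx => //.
  apply: gs; rewrite [s]splitr; apply: ball_triangle (le_ball _ yz).
    near: y; apply: nbhsx_ballx; rewrite divr_gt0//.
  near: r; apply: nbhs_right_le; rewrite divr_gt0//.
near (0 : R)^'+ => r; exists r; first by near: r; exact: nbhs_right_gt.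
by move=> [x y] /=; move: x y; near: r.
Unshelve. all: by end_near. Qed.

Lemma metric_ball_open (R : realType) (X : metricType R) (x : X) (r : R) :
  open (ball x r).
Proof.
rewrite openE => y; rewrite /interior ballEmdist /= => xy; apply/nbhs_ballP.
exists (r - mdist x y) => /=; first by rewrite subr_gt0.
by move=> z; rewrite !ballEmdist /= ltrBrDl; apply: le_lt_trans;
  exact: metric_triangle.
Qed.

Lemma near_ball_continuous (R : realType) (X : topologicalType)
    (Y : pseudoMetricType R) (g : X -> Y) :
  (forall x (e : R), 0 < e -> \forall y \near x, ball (g x) e (g y)) ->
  continuous g.
Proof. by move=> gball x; apply/cvg_ballP => e e0; exact: gball. Qed.

Lemma compact_mdist_bounded (R : realType) (X : pmetricType R) :
  compact [set: X] -> exists2 C : R, 0 < C & forall x y : X, mdist x y <= C.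
Proof.
move=> Xc; have [x|C C0 dC] := compact_continuous_bounded Xc (g := mdist point).
  apply/cvgrPdist_lt => e e0; apply/nbhs_ballP; exists e => // y.
  rewrite ballEmdist /=.
  have := metric_triangle point x y; have := metric_triangle point y x.
  by rewrite (metric_sym y x) ltr_norml => ? ? ?; apply/andP; split; lra.
exists (C + C) => [|x y]; first exact: addr_gt0.
rewrite (le_trans (metric_triangle x point y))// (metric_sym x) lerD//.
  exact: le_trans (ler_norm _) (dC x).
exact: le_trans (ler_norm _) (dC y).
Qed.

(** * Positive functionals *)

Section PositiveFunctional.
Variables (R : realType) (X : topologicalType).
Implicit Types (a c e : R) (g h : X -> R).

Lemma continuous_scale a g : continuous g -> continuous (fun x => a * g x).
Proof. by move=> gc x; exact: cvgMl_tmp (gc x). Qed.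

Lemma continuous_sum n (F : nat -> X -> R) : (forall k, continuous (F k)) ->
  continuous (fun x => \sum_(k < n) F k x).
Proof.
move=> Fc; elim: n => [|n IH] x.
  by under eq_fun do rewrite big_ord0; exact: cst_continuous.
by under eq_fun do rewrite big_ord_recr; apply: cvgD; [exact: IH|exact: Fc].
Qed.

Definition positive_functional (l : (X -> R) -> R) :=
  (forall a g h, continuous g -> continuous h ->
     l (fun x => a * g x + h x) = a * l g + l h) /\
  (forall g, continuous g -> (forall x, 0 <= g x) -> 0 <= l g).

Variable l : (X -> R) -> R.
Hypothesis lpos : positive_functional l.

Lemma positive_functional0 : l (fun=> 0) = 0.
Proof.
rewrite -[RHS](addNr (l (fun=> 0))) -mulN1r -lpos.1; try exact: cst_continuous.
by congr l; apply/funext => x; rewrite mulr0 addr0.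
Qed.

Lemma positive_functionalZ a g : continuous g -> l (fun x => a * g x) = a * l g.
Proof.
move=> gc; rewrite -[RHS]addr0 -positive_functional0 -lpos.1//.
  by congr l; apply/funext => x; rewrite addr0.
exact: cst_continuous.
Qed.

Lemma positive_functionalD g h : continuous g -> continuous h ->
  l (fun x => g x + h x) = l g + l h.
Proof.
move=> gc hc; rewrite -[l g]mul1r -lpos.1//.
by congr l; apply/funext => x; rewrite mul1r.
Qed.

Lemma positive_functionalB g h : continuous g -> continuous h ->
  l (fun x => g x - h x) = l g - l h.
Proof.
move=> gc hc; rewrite addrC -mulN1r -lpos.1//.
by congr l; apply/funext => x; rewrite mulN1r addrC.
Qed.

Lemma positive_functional_cst c : l (fun=> c) = c * l (fun=> 1).
Proof.
rewrite -positive_functionalZ; last exact: cst_continuous.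
by congr l; apply/funext => x; rewrite mulr1.
Qed.

Lemma positive_functional_le g h : continuous g -> continuous h ->
  (forall x, g x <= h x) -> l g <= l h.
Proof.
move=> gc hc gh; rewrite -subr_ge0 -positive_functionalB//.
by apply: lpos.2 => x; [exact: cvgB (hc x) (gc x)|rewrite subr_ge0].
Qed.

Lemma positive_functional_sum n (F : nat -> X -> R) :
  (forall k, continuous (F k)) ->
  l (fun x => \sum_(k < n) F k x) = \sum_(k < n) l (F k).
Proof.
move=> Fc; elim: n => [|n IH].
  rewrite big_ord0 -[RHS]positive_functional0; congr l.
  by apply/funext => x; rewrite big_ord0.
rewrite big_ord_recr /= -IH -positive_functionalD//; last exact: continuous_sum.
by congr l; apply/funext => x; rewrite big_ord_recr.
Qed.

Lemma positive_functional_dist g h e : continuous g -> continuous h ->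
  (forall x, `|g x - h x| <= e) -> `|l g - l h| <= e * l (fun=> 1).
Proof.
move=> gc hc gh; have ghc : continuous (fun x => g x - h x).
  by move=> x; exact: cvgB (gc x) (hc x).
rewrite -positive_functionalB// ler_norml -mulNr -!positive_functional_cst.
by apply/andP; split; apply: positive_functional_le => //;
  try exact: cst_continuous; move=> x; have := gh x;
    rewrite ler_norml => /andP[].
Qed.

End PositiveFunctional.
Arguments continuous_scale {R X} a {g}.

(* In use, [i] is the identity from a set with its Borel sigma-algebra to the
   same set with its topology: these structures live on different types. *)
Section IntegralFunctional.
Variables (R : realType) (X : topologicalType).
Variables (disp : measure_display) (S : measurableType disp) (i : S -> X).
Hypothesis i_borel : forall U, open U -> measurable (i @^-1` U).
Hypothesis Xc : compact [set: X].
Variable m : {finite_measure set S -> \bar R}.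
Implicit Types (g : X -> R).

Lemma continuous_measurable_comp g : continuous g ->
  measurable_fun setT (g \o i).
Proof.
move=> gc; apply: (measurability _ (RGenOInfty.measurableE R)).
move=> _ [_ [c ->] <-]; rewrite setTI comp_preimage; apply: i_borel.
by apply: open_comp => [x _|]; [exact: gc|exact: interval_open].
Qed.

Lemma continuous_integrable g : continuous g ->
  m.-integrable setT (EFin \o (g \o i)).
Proof.
move=> gc; have [C C0 gC] := compact_continuous_bounded Xc gc.
apply: measurable_bounded_integrable => //.
- by rewrite -ge0_fin_numE// fin_num_measure.
- exact: continuous_measurable_comp.
- exists C; split; first by rewrite num_real.
  by move=> D CD x _; exact: le_trans (gC _) (ltW CD).
Qed.

Lemma Rintegral_positive_functional :
  positive_functional (fun g => \int[m]_s g (i s)).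
Proof.
split=> [a g h gc hc|g gc g0]; last by apply: Rintegral_ge0 => s _.
have agi : m.-integrable setT (EFin \o (fun s => a * g (i s))).
  by apply: (@continuous_integrable (fun x => a * g x));
    exact: continuous_scale.
rewrite (RintegralD measurableT agi (continuous_integrable hc)).
by rewrite (RintegralZl _ measurableT (continuous_integrable gc)).
Qed.

End IntegralFunctional.

Section RintegralIndic.
Context {disp} {S : measurableType disp} {R : realType}.
Variable m : {finite_measure set S -> \bar R}.
Variables (A : set S) (t : R) (g : S -> R).
Hypotheses (mA : measurable A) (gi : m.-integrable setT (EFin \o g)).

Let integrable_indicZ : m.-integrable setT (EFin \o (fun s => t * \1_A s)).
Proof. exact: (integrableZl measurableT t (integrable_indic m mA)). Qed.

Let Rintegral_indicZ : \int[m]_s (t * \1_A s) = t * fine (m A).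
Proof.
rewrite RintegralZl//; last exact: integrable_indic.
by rewrite /Rintegral integral_indic// setIT.
Qed.

Lemma Rintegral_ge_indic : (forall s, t * \1_A s <= g s) ->
  t * fine (m A) <= \int[m]_s g s.
Proof.
move=> gA; rewrite -Rintegral_indicZ.
by apply: (le_Rintegral measurableT) => //; exact: integrable_indicZ.
Qed.

Lemma Rintegral_le_indic : (forall s, g s <= t * \1_A s) ->
  \int[m]_s g s <= t * fine (m A).
Proof.
move=> gA; rewrite -Rintegral_indicZ.
by apply: (le_Rintegral measurableT) => //; exact: integrable_indicZ.
Qed.

End RintegralIndic.

Lemma full_support_ball_ge (R : realType) (X : pmetricType R)
    (disp : measure_display) (S : measurableType disp) (i : S -> X)
    (m : {finite_measure set S -> \bar R}) :
  compact [set: X] -> (forall U, open U -> measurable (i @^-1` U)) ->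
  (forall U, open U -> U !=set0 -> (0 < m (i @^-1` U))%E) ->
  forall r : R, 0 < r ->
    exists2 c : R, 0 < c & forall x, c <= fine (m (i @^-1` ball x r)).
Proof.
move=> Xc i_borel m_supp r r0.
have mball x s := i_borel _ (metric_ball_open x s).
have cm : \forall c \near 0^'+, forall x, c <= fine (m (i @^-1` ball x r)).
  apply: (compact_near_forall Xc) => x; near=> y c => /=.
  apply: (@le_trans _ _ (fine (m (i @^-1` ball x (r / 2))))).
    near: c; apply: nbhs_right_le; apply: fine_gt0.
    rewrite m_supp /=; last 2 first.
    - exact: metric_ball_open.
    - by exists x; apply: ballxx; rewrite divr_gt0.
    by rewrite -ge0_fin_numE// fin_num_measure.
  apply: fine_le; rewrite ?fin_num_measure//; apply: le_measure; rewrite ?inE//.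
  move=> z /=; rewrite [r in ball y r]splitr; apply: ball_triangle.
  by apply: ball_sym; near: y; apply: nbhsx_ballx; rewrite divr_gt0.
near (0 : R)^'+ => c; exists c; first by near: c; exact: nbhs_right_gt.
by near: c.
Unshelve. all: by end_near. Qed.

Section LipIndic.
Variables (R : realType) (X : metricType R) (U : set X).
Implicit Types (x y : X) (k : nat).

Let candidates k x : set R := 1 |` [set k%:R * mdist x y | y in ~` U].

Definition lip_indic k x : R := inf (candidates k x).

Let candidates_ge0 k x : lbound (candidates k x) 0.
Proof. by move=> _ [->|[y _ <-]] //; rewrite mulr_ge0// mdist_ge0. Qed.

Let lip_indic_le k x r : candidates k x r -> lip_indic k x <= r.
Proof. by move=> xr; apply: ge_inf => //; exists 0; exact: candidates_ge0. Qed.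

Let le_lip_indic k x r : lbound (candidates k x) r -> r <= lip_indic k x.
Proof. by move=> rx; apply: lb_le_inf => //; exists 1; left. Qed.

Lemma lip_indic_ge0 k x : 0 <= lip_indic k x.
Proof. exact/le_lip_indic/candidates_ge0. Qed.

Lemma lip_indic_le1 k x : lip_indic k x <= 1.
Proof. by apply: lip_indic_le; left. Qed.

Lemma lip_indic_out k x : ~ U x -> lip_indic k x = 0.
Proof.
move=> Ux; apply/eqP; rewrite eq_le lip_indic_ge0 andbT; apply: lip_indic_le.
by right; exists x => //; rewrite mdistxx mulr0.
Qed.

Lemma lip_indic_nondecreasing x : nondecreasing_seq (lip_indic ^~ x).
Proof.
move=> k n kn; apply: le_lip_indic => _ [->|[y Uy <-]];
  first exact: lip_indic_le1.
apply: (@le_trans _ _ (k%:R * mdist x y)).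
  by apply: lip_indic_le; right; exists y.
by rewrite ler_wpM2r ?mdist_ge0// ler_nat.
Qed.

Lemma near_lip_indic_eq1 x : open U -> U x ->
  \forall k \near \oo, lip_indic k x = 1.
Proof.
rewrite openE => Uo /Uo/nbhs_ballP[r /= r0 rU]; near=> k.
apply/eqP; rewrite eq_le lip_indic_le1.
apply: le_lip_indic => _ [->//|[y Uy <-]].
apply: (@le_trans _ _ (k%:R * r)).
  by rewrite -ler_pdivrMr// div1r; near: k; exact: nbhs_infty_ger.
rewrite ler_wpM2l// leNgt; apply/negP => xy.
by apply/Uy/rU; rewrite ballEmdist.
Unshelve. all: by end_near. Qed.

Lemma cvg_lip_indic x : open U -> lip_indic k x @[k --> \oo] --> (\1_U x : R).
Proof.
move=> Uo; rewrite indicE; have [|/negP] := boolP (x \in U); rewrite inE => Ux.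
  by apply: cvg_near_cst; exact: near_lip_indic_eq1.
by under eq_fun do rewrite lip_indic_out//; exact: cvg_cst.
Qed.

Lemma lip_indic_continuous k : continuous (lip_indic k).
Proof.
have lip x y : lip_indic k x - k%:R * mdist x y <= lip_indic k y.
  have k0 : 0 <= k%:R :> R by [].
  apply: le_lip_indic => _ [->|[z Uz <-]].
    by rewrite lerBlDr (le_trans (lip_indic_le1 k x))// lerDl mulr_ge0//
      mdist_ge0.
  rewrite lerBlDl -mulrDr; apply: (@le_trans _ _ (k%:R * mdist x z)).
    by apply: lip_indic_le; right; exists z.
  by rewrite ler_wpM2l// metric_triangle.
move=> x; apply/cvgrPdist_lt => e e0; apply/nbhs_ballP.
exists (e / k.+1%:R) => /=; first by rewrite divr_gt0.
move=> y; rewrite ballEmdist /= ltr_pdivlMr// -natr1 mulrC => xy.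
have := lip x y; have := lip y x; have := mdist_ge0 x y.
rewrite (metric_sym y x) ltr_norml => xy0 ? ?.
by apply/andP; split; nra.
Qed.

End LipIndic.

Section BorelFiniteMeasure.
Variables (R : realType) (X : pmetricType R).
Local Notation S := (g_sigma_algebraType (@open X)).
Implicit Types (U : set X) (m : {finite_measure set S -> \bar R}).

Lemma open_measurable_id U : open U -> measurable ((id : S -> X) @^-1` U).
Proof. exact: sub_sigma_algebra. Qed.

Lemma continuous_borel_integrable m (g : X -> R) : compact [set: X] ->
  continuous g -> m.-integrable setT (EFin \o (g : S -> R)).
Proof. by move=> Xc; exact: (continuous_integrable open_measurable_id Xc). Qed.

Lemma Rintegral_borel_positive_functional m : compact [set: X] ->
  positive_functional (fun g : X -> R => \int[m]_x g x).
Proof.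
by move=> Xc; exact: Rintegral_positive_functional open_measurable_id Xc m.
Qed.

Lemma cvg_Rintegral_lip_indic m U : open U ->
  \int[m]_x lip_indic U k x @[k --> \oo] --> fine (m U).
Proof.
move=> Uo; have mU := open_measurable_id Uo.
apply: fine_cvg; rewrite fineK ?fin_num_measure//.
have <- : (\int[m]_x (\1_U x)%:E = m U)%E by rewrite integral_indic// setIT.
have lim_lip x : limn (fun k => (lip_indic U k x)%:E) = (\1_U x : R)%:E.
  apply: cvg_lim => //; apply/fine_cvgP; split; first exact: nearW.
  exact: cvg_lip_indic.
under [X in _ --> X]eq_integral do rewrite -lim_lip.
apply: cvg_monotone_convergence => //.
- move=> k; apply/measurable_EFinP.
  apply: (@continuous_measurable_comp _ _ _ _ _ open_measurable_id
    (lip_indic U k)).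
  exact: lip_indic_continuous.
- by move=> k x _; rewrite lee_fin lip_indic_ge0.
- by move=> x _ k n kn; rewrite lee_fin; exact: lip_indic_nondecreasing.
Qed.

Lemma finite_measure_unique m1 m2 :
  (forall g : X -> R, continuous g -> \int[m1]_x g x = \int[m2]_x g x) ->
  forall A : set S, measurable A -> m1 A = m2 A.
Proof.
move=> m12 A mA.
apply: (@measure_unique _ R S (@open X) (fun=> setT) _ _ _ _ m1 m2) => //.
- exact: openI.
- by move=> _; exact: openT.
- by rewrite bigcup_const//; exists 0%N.
- move=> U Uo; have mU := open_measurable_id Uo.
  rewrite -[LHS]fineK ?fin_num_measure// -[RHS]fineK ?fin_num_measure//.
  congr EFin; apply: cvg_unique (cvg_Rintegral_lip_indic (m := m1) Uo) _ => //.
  rewrite (_ : (fun _ => _) = fun k => \int[m2]_x lip_indic U k x).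
    exact: cvg_Rintegral_lip_indic.
  by apply/funext => k; apply: m12; exact: lip_indic_continuous.
- by move=> _; rewrite -ge0_fin_numE// fin_num_measure.
Qed.

End BorelFiniteMeasure.

(** * Riesz representation *)

Section Layers.
Variables (R : realType) (X : topologicalType) (s : R) (g : X -> R).
Hypothesis s_ge0 : 0 <= s.

Definition layer k x := Num.min (g x) (k.+1%:R * s) - Num.min (g x) (k%:R * s).

Let levelS k : k.+1%:R * s = k%:R * s + s.
Proof. by rewrite -natr1 mulrDl mul1r. Qed.

Lemma layer_ge_indic k x : s * \1_[set y | k.+1%:R * s < g y] x <= layer k x.
Proof.
rewrite indicE /layer levelS.
have [|/negP] := boolP (x \in _); rewrite inE /= => gx.
  by rewrite mulr1 !min_r; move: s_ge0; lra.
by rewrite mulr0 subr_ge0 le_min !ge_min lexx /= lerDl s_ge0 orbT.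
Qed.

Lemma layer_ge0 k x : 0 <= layer k x.
Proof. by apply: le_trans (layer_ge_indic k x); rewrite mulr_ge0. Qed.

Lemma layer_le_indic k x : layer k x <= s * \1_[set y | k%:R * s < g y] x.
Proof.
rewrite indicE /layer levelS.
have [|/negP] := boolP (x \in _); rewrite inE /= => gx.
  by rewrite mulr1 (min_r (ltW gx)) lerBlDl ge_min lexx orbT.
by move/negP: gx; rewrite -leNgt => gx; rewrite !min_l; move: s_ge0; lra.
Qed.

Lemma layer_continuous k : continuous g -> continuous (layer k).
Proof.
move=> gc x.
have minc c : {for x, continuous (fun y => Num.min (g y) c)}.
  exact: (continuous_min (gc x) (@cst_continuous _ _ c x)).
exact: cvgB (minc _) (minc _).
Qed.

Lemma sum_layer n x : 0 <= g x -> g x <= n%:R * s ->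
  \sum_(k < n) layer k x = g x.
Proof.
move=> g0 gn; rewrite -(big_mkord xpredT (layer ^~ x)).
rewrite (telescope_sumr (fun k => Num.min (g x) (k%:R * s)))// mul0r.
by rewrite (min_idPl gn) (min_idPr g0) subr0.
Qed.

End Layers.

Section RieszRepresentation.
Variables (R : realType) (X : pmetricType R).
Implicit Types (A B U : set X) (g : X -> R) (F : nat -> X -> R).

Definition daniell_cover A F :=
  [/\ forall n, continuous (F n), forall n x, 0 <= F n x,
      forall x, nondecreasing_seq (F ^~ x) &
      forall x, A x -> forall e : R, 0 < e -> exists n, 1 - e < F n x].

Lemma daniell_cover_cst A g : continuous g -> (forall x, 0 <= g x) ->
  (forall x, A x -> 1 <= g x) -> daniell_cover A (fun=> g).
Proof.
move=> gc g0 gA; split=> // [x m n _ //|x Ax e e0]; exists 0%N.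
by apply: lt_le_trans (gA x Ax); rewrite ltrBlDr ltrDl.
Qed.

Lemma daniell_coverS A B F : A `<=` B -> daniell_cover B F -> daniell_cover A F.
Proof. by move=> AB [Fc F0 Fnd FB]; split=> // x /AB; exact: FB. Qed.

Lemma daniell_cover_bigcup (A : (set X)^nat) (F : nat -> nat -> X -> R) :
  (forall k, daniell_cover (A k) (F k)) ->
  daniell_cover (\bigcup_k A k) (fun n x => \sum_(k < n) F k n x).
Proof.
move=> AF.
have Fge0 k n x : 0 <= F k n x by case: (AF k).
split=> [n|n x|x|x [k _ Akx] e e0].
- by apply: (continuous_sum (F := F ^~ n)) => k; case: (AF k).
- exact: sumr_ge0.
- apply/nondecreasing_seqP => n; rewrite big_ord_recr /= -[leLHS]addr0 lerD//.
  by apply: ler_sum => k _; case: (AF k) => _ _ + _; apply.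
- have [_ _ Fnd /(_ x Akx e e0)[n Fn]] := AF k.
  exists (maxn n k.+1); apply: (lt_le_trans Fn).
  apply: (le_trans (Fnd x _ _ (leq_maxl n k.+1))).
  by rewrite (bigD1 (Ordinal (leq_maxr n k.+1)))//= lerDl sumr_ge0.
Qed.

Lemma daniell_cover_setI_open A F U : daniell_cover A F -> open U ->
  daniell_cover (A `&` U) (fun n x => F n x * lip_indic U n x).
Proof.
move=> [Fc F0 Fnd FA] Uo; split=> [n x|n x|x m n mn|x [Ax Ux] e e0].
- by apply: cvgM; [exact: Fc|exact: lip_indic_continuous].
- by rewrite mulr_ge0// lip_indic_ge0.
- by apply: ler_pM; rewrite ?lip_indic_ge0 ?Fnd ?lip_indic_nondecreasing.
- have [N FN] := FA x Ax e e0; near \oo => n; exists n.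
  rewrite (near (near_lip_indic_eq1 Uo Ux) n)// mulr1 (lt_le_trans FN)//.
  by apply: Fnd; near: n; exact: nbhs_infty_ge.
Unshelve. all: by end_near. Qed.

Lemma daniell_cover_setD A F U k : daniell_cover A F ->
  daniell_cover (A `&` ~` U) (fun n x => F n x * (1 - lip_indic U k x)).
Proof.
move=> [Fc F0 Fnd FA].
have b0 x : 0 <= 1 - lip_indic U k x by rewrite subr_ge0 lip_indic_le1.
split=> [n x|n x|x m n mn|x [Ax Ux] e e0].
- apply: cvgM; first exact: Fc.
  by apply: cvgB; [exact: cvg_cst|exact: lip_indic_continuous].
- by rewrite mulr_ge0.
- by rewrite ler_wpM2r// Fnd.
- by have [n Fn] := FA x Ax e e0; exists n; rewrite lip_indic_out// subr0 mulr1.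
Qed.

Variable l : (X -> R) -> R.
Hypothesis lpos : positive_functional l.

Definition daniell_cost F : \bar R := ereal_sup (range (fun n => (l (F n))%:E)).

Definition daniell_outer A : \bar R :=
  ereal_inf (daniell_cost @` daniell_cover A).

Lemma daniell_outer_le A F (c : \bar R) : daniell_cover A F ->
  (forall n, ((l (F n))%:E <= c)%E) -> (daniell_outer A <= c)%E.
Proof.
move=> AF lc; apply: (@le_trans _ _ (daniell_cost F)).
  by apply: ereal_inf_lbound; exists F.
by apply: ge_ereal_sup => _ [n _ <-]; exact: lc.
Qed.

Lemma le_daniell_outer A (c : \bar R) :
  (forall F, daniell_cover A F -> (c <= daniell_cost F)%E) ->
  (c <= daniell_outer A)%E.
Proof. by move=> cF; apply: le_ereal_inf_tmp => _ [F AF <-]; exact: cF. Qed.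

Lemma daniell_cost_ge F n : ((l (F n))%:E <= daniell_cost F)%E.
Proof. by apply: ereal_sup_ubound; exists n. Qed.

Lemma daniell_outer_ge0 A : (0 <= daniell_outer A)%E.
Proof.
apply: le_daniell_outer => F [Fc F0 _ _]; apply: le_trans (daniell_cost_ge F 0).
by rewrite lee_fin; apply: lpos.2.
Qed.

Lemma daniell_outer_le_cst A : (daniell_outer A <= (l (fun=> 1))%:E)%E.
Proof.
apply: (@daniell_outer_le _ (fun=> fun=> 1)) => //.
by apply: daniell_cover_cst => //; exact: cst_continuous.
Qed.

Lemma daniell_outer_fin_num A : daniell_outer A \is a fin_num.
Proof.
rewrite ge0_fin_numE ?daniell_outer_ge0//.
exact: le_lt_trans (daniell_outer_le_cst A) (ltry _).
Qed.

Lemma daniell_outer_adherent A (e : R) : 0 < e ->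
  exists2 F, daniell_cover A F &
    forall n, ((l (F n))%:E <= daniell_outer A + e%:E)%E.
Proof.
move=> e0; have [_ [F AF <-] /ltW cF] :=
  lb_ereal_inf_adherent e0 (daniell_outer_fin_num A).
by exists F => // n; exact: le_trans (daniell_cost_ge F n) cF.
Qed.

Lemma daniell_outer0 : daniell_outer set0 = 0%E.
Proof.
apply/eqP; rewrite eq_le daniell_outer_ge0 andbT.
apply: (@daniell_outer_le _ (fun=> fun=> 0)) => [|n].
  by apply: daniell_cover_cst => //; exact: cst_continuous.
by rewrite positive_functional0.
Qed.

Lemma daniell_outer_subset :
  {homo daniell_outer : A B / A `<=` B >-> (A <= B)%E}.
Proof.
move=> A B AB; apply: le_daniell_outer => F /(daniell_coverS AB) AF.
by apply: daniell_outer_le AF _ => n; exact: daniell_cost_ge.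
Qed.

Lemma daniell_outer_sigma_subadditive : sigma_subadditive daniell_outer.
Proof.
move=> A; apply/lee_addgt0Pr => e e0.
have /choice[F AF] k : exists F, daniell_cover (A k) F /\ forall n,
    ((l (F n))%:E <= daniell_outer (A k) + (e / (2 ^ k.+1)%:R)%:E)%E.
  have [|F AF lF] := @daniell_outer_adherent (A k) (e / (2 ^ k.+1)%:R).
    by rewrite divr_gt0// ltr0n expn_gt0.
  by exists F.
apply: le_trans (epsilon_trick xpredT (fun k => daniell_outer_ge0 (A k))
  (ltW e0)).
apply: (daniell_outer_le (daniell_cover_bigcup (fun k => (AF k).1))) => n.
rewrite (@positive_functional_sum _ _ _ lpos n (F ^~ n)); last first.
  by move=> k; case: (AF k) => -[].
apply: (@le_trans _ _ (\sum_(0 <= k < n)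
    (daniell_outer (A k) + (e / (2 ^ k.+1)%:R)%:E))%E).
  by rewrite big_mkord -sumEFin lee_sum// => k _; exact: (AF k).2.
apply: nneseries_lim_ge => k _ _.
by rewrite adde_ge0// ?daniell_outer_ge0// lee_fin divr_ge0// ltW.
Qed.

HB.instance Definition _ := isOuterMeasure.Build R X daniell_outer
  daniell_outer0 daniell_outer_ge0 daniell_outer_subset
  daniell_outer_sigma_subadditive.

Lemma open_caratheodory U : open U -> daniell_outer.-caratheodory U.
Proof.
move=> Uo; apply: le_caratheodory_measurable => A /=.
apply/lee_addgt0Pr => e e0; have [F AF lF] := daniell_outer_adherent A e0.
have [Fc F0 Fnd _] := AF.
have lip0 k x := lip_indic_ge0 U k x.
have lip1 k x : 0 <= 1 - lip_indic U k x by rewrite subr_ge0 lip_indic_le1.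
have inc := daniell_cover_setI_open AF Uo.
have dec k := daniell_cover_setD U k AF.
rewrite -leeBrDr ?daniell_outer_fin_num//.
apply: (daniell_outer_le inc) => k.
rewrite leeBrDr ?daniell_outer_fin_num// addeC -leeBrDr//.
apply: (daniell_outer_le (dec k)) => n; rewrite leeBrDr//.
apply: le_trans (lF (maxn n k)); rewrite -EFinD lee_fin.
have [[Fdc _ _ _] [Fic _ _ _]] := (dec k, inc).
rewrite -positive_functionalD//; apply: positive_functional_le => //.
  by move=> x; exact: cvgD (Fdc n x) (Fic k x).
move=> x; set N := maxn n k.
have -> : F N x = F N x * (1 - lip_indic U k x) + F N x * lip_indic U k x.
  by rewrite -mulrDr subrK mulr1.
by rewrite lerD// ler_wpM2r// Fnd// ?leq_maxl ?leq_maxr.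
Qed.

Local Notation S := (g_sigma_algebraType (@open X)).

Definition riesz_measure : set S -> \bar R := daniell_outer.

Let borel_caratheodory (A : set S) :
  measurable A -> daniell_outer.-caratheodory A.
Proof.
apply: smallest_sub; last exact: open_caratheodory.
exact: (@sigma_algebra_measurable _ (caratheodory_type daniell_outer)).
Qed.

Let riesz_measure_sigma_additive : semi_sigma_additive riesz_measure.
Proof.
move=> F mF tF mUF; rewrite /riesz_measure.
apply: caratheodory_measure_sigma_additive => //;
  last exact: borel_caratheodory.
by move=> i; exact: borel_caratheodory (mF i).
Qed.

HB.instance Definition _ := isMeasure.Build _ _ _ riesz_measure
  daniell_outer0 daniell_outer_ge0 riesz_measure_sigma_additive.

HB.instance Definition _ := Measure_isFinite.Build _ _ _ riesz_measure
  (fun A _ => daniell_outer_fin_num A).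

Hypothesis Xc : compact [set: X].

Lemma riesz_measureT : riesz_measure setT = (l (fun=> 1))%:E.
Proof.
apply/eqP; rewrite eq_le daniell_outer_le_cst/=.
apply: le_daniell_outer => F [Fc F0 Fnd FT]; have onec := @cst_continuous X R 1.
apply/lee_addgt0Pr => e e0; have l10 : 0 <= l (fun=> 1) by apply: lpos.2.
have d0 : 0 < e / (l (fun=> 1) + 1) by rewrite divr_gt0// ltr_wpDl.
have [x r r0|N _ /(_ N (leqnn N)) F1] := dini Xc onec Fc Fnd _ d0.
  by have [n] := FT x I r r0; exists n; rewrite -ltrBlDr.
apply: (@le_trans _ _ ((l (F N))%:E + e%:E)%E); last first.
  by rewrite leeD2r// daniell_cost_ge.
rewrite -EFinD lee_fin.
apply: (@le_trans _ _ (l (fun x => F N x + e / (l (fun=> 1) + 1)))).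
  apply: positive_functional_le => // [x|x]; last exact/ltW/F1.
  by apply: cvgD; [exact: Fc|exact: cvg_cst].
rewrite positive_functionalD//; last exact: cst_continuous.
rewrite lerD2l positive_functional_cst// mulrAC ler_pdivrMr ?ltr_wpDl//.
by rewrite ler_pM2l// lerDl.
Qed.

Lemma riesz_measure_le (A : set S) g : continuous g -> (forall x, 0 <= g x) ->
  (forall x, A x -> 1 <= g x) -> fine (riesz_measure A) <= l g.
Proof.
move=> gc g0 gA; rewrite -lee_fin fineK ?daniell_outer_fin_num//.
exact: daniell_outer_le (daniell_cover_cst gc g0 gA) (fun=> lexx _).
Qed.

Let Rintegral_positive :=
  Rintegral_borel_positive_functional riesz_measure Xc.

(* The integral of each layer of [g] is at most the functional on the layer
   below, so the two sides differ by the bottom layer only. *)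
Let Rintegral_layer_le (s : R) (g : X -> R) k : 0 < s -> continuous g ->
  \int[riesz_measure]_x layer s g k.+1 x <= l (layer s g k).
Proof.
move=> s0 gc; have lc j := @layer_continuous _ _ s g j gc.
pose U : set S := [set x | k.+1%:R * s < g x].
apply: (@le_trans _ _ (s * fine (riesz_measure U))).
  apply: Rintegral_le_indic.
    exact: sub_sigma_algebra (open_superlevel _ gc).
    exact: continuous_borel_integrable.
  by move=> x; apply: layer_le_indic; exact: ltW.
rewrite -ler_pdivlMl// -positive_functionalZ//; apply: riesz_measure_le.
- exact: continuous_scale.
- by move=> x; rewrite mulr_ge0 ?invr_ge0 ?layer_ge0// ltW.
- move=> x Ux; rewrite ler_pdivlMl// mulr1.
  apply: le_trans (layer_ge_indic g (ltW s0) k x).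
  by rewrite indicE mem_set ?mulr1.
Qed.

Let Rintegral_riesz_measure_le_ge0 (g : X -> R) : continuous g ->
  (forall x, 0 <= g x) -> \int[riesz_measure]_x g x <= l g.
Proof.
move=> gc g0; have [C C0 gC] := compact_continuous_bounded Xc gc.
have l10 : 0 <= l (fun=> 1) by apply: lpos.2 => //; exact: cst_continuous.
apply/ler_addgt0Pl => e e0; pose s := e / (l (fun=> 1) + 1).
have s0 : 0 < s by rewrite divr_gt0// ltr_wpDl.
have lc j := @layer_continuous _ _ s g j gc.
have [n Cn] : exists n : nat, C <= n%:R * s.
  exists (Num.truncn (C / s)).+1.
  by rewrite -ler_pdivrMr// ltW// truncnS_gt.
have gn j x : (n <= j)%N -> \sum_(k < j) layer s g k x = g x.
  move=> nj; apply: sum_layer => //; apply: le_trans (ler_norm _) _.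
  by apply: le_trans (gC x) (le_trans Cn _); rewrite ler_pM2r// ler_nat.
rewrite -[in leLHS](funext (gn n.+1 ^~ (leqnSn n))).
rewrite -[in leRHS](funext (gn n ^~ (leqnn n))).
rewrite (positive_functional_sum Rintegral_positive)//
  positive_functional_sum//.
rewrite big_ord_recl lerD//; last first.
  by apply: ler_sum => k _; exact: Rintegral_layer_le.
apply: (@le_trans _ _ (\int[riesz_measure]_x s)).
  apply: (positive_functional_le Rintegral_positive) => //.
    exact: cst_continuous.
  move=> x; apply: le_trans (layer_le_indic g (ltW s0) 0 x) _.
  by rewrite ler_piMr ?(ltW s0)// indicE lern1 leq_b1.
rewrite Rintegral_cst//= riesz_measureT /= mulrAC ler_pdivrMr ?ltr_wpDl//.
by rewrite ler_pM2l// lerDl.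
Qed.

Let Rintegral_riesz_measure_le (g : X -> R) : continuous g ->
  \int[riesz_measure]_x g x <= l g.
Proof.
move=> gc; have [C C0 gC] := compact_continuous_bounded Xc gc.
have Cc := @cst_continuous X R C.
have gCc : continuous (fun x => g x + C) by move=> x; exact: cvgD (gc x) (Cc x).
have : \int[riesz_measure]_x (g x + C) <= l (fun x => g x + C).
  apply: Rintegral_riesz_measure_le_ge0 => // x.
  by have := gC x; rewrite ler_norml -subr_ge0 opprK addrC => /andP[].
rewrite (positive_functionalD Rintegral_positive)// positive_functionalD//.
rewrite Rintegral_cst//= riesz_measureT /=.
by rewrite (positive_functional_cst lpos C) lerD2r.
Qed.

Lemma Rintegral_riesz_measure (g : X -> R) : continuous g ->
  \int[riesz_measure]_x g x = l g.
Proof.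
move=> gc; apply/eqP; rewrite eq_le Rintegral_riesz_measure_le//=.
have := Rintegral_riesz_measure_le (continuous_scale (-1) gc).
rewrite (positive_functionalZ Rintegral_positive)// positive_functionalZ//.
by rewrite !mulN1r lerN2.
Qed.

Hypothesis l1 : l (fun=> 1) = 1.

Let riesz_measure_setT1 : riesz_measure setT = 1%E.
Proof. by rewrite riesz_measureT l1. Qed.

HB.instance Definition _ :=
  Measure_isProbability.Build _ _ _ riesz_measure riesz_measure_setT1.

Theorem riesz_representation : exists P : probability S R,
  forall g : X -> R, continuous g -> \int[P]_x g x = l g.
Proof. by exists riesz_measure; exact: Rintegral_riesz_measure. Qed.

End RieszRepresentation.

(** * Positive operators *)

Section PositiveOperator.
Variables (R : realType) (X : topologicalType).
Implicit Types (L : (X -> R) -> X -> R) (g h : X -> R) (a c : R).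

Definition positive_operator L :=
  (forall g, continuous g -> continuous (L g)) /\
  (forall x, positive_functional (L ^~ x)).

Section Properties.
Variable L : (X -> R) -> X -> R.
Hypothesis Lpos : positive_operator L.

Lemma positive_operatorB g h x : continuous g -> continuous h ->
  L (fun y => g y - h y) x = L g x - L h x.
Proof. exact: (positive_functionalB (Lpos.2 x)). Qed.

Lemma positive_operatorZ a g x : continuous g ->
  L (fun y => a * g y) x = a * L g x.
Proof. exact: (positive_functionalZ (Lpos.2 x)). Qed.

Lemma positive_operator_cst c x : L (fun=> c) x = c * L (fun=> 1) x.
Proof. exact: (positive_functional_cst (Lpos.2 x)). Qed.

Lemma positive_operator_le g h : continuous g -> continuous h ->
  (forall x, g x <= h x) -> forall x, L g x <= L h x.
Proof. by move=> gc hc gh x; exact: (positive_functional_le (Lpos.2 x)). Qed.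

End Properties.

Lemma positive_operator_iter L n :
  positive_operator L -> positive_operator (iter n L).
Proof.
move=> Lpos; elim: n => [|n [Lnc Lnpos]].
  by split=> // x; split=> // g gc g0; exact: g0.
split=> [g gc|x]; first exact/Lpos.1/Lnc.
split=> [a g h gc hc|g gc g0] /=; last first.
  by apply: (Lpos.2 x).2 => [|y]; [exact: Lnc|exact: (Lnpos y).2].
have -> : iter n L (fun y => a * g y + h y) =
    fun y => a * iter n L g y + iter n L h y.
  by apply/funext => y; exact: (Lnpos y).1.
by apply: (Lpos.2 x).1; exact: Lnc.
Qed.

End PositiveOperator.

Section PerronFrobenius.
Variables (R : realType) (X : pmetricType R).
Implicit Types (x y z : X) (g : X -> R) (n m k : nat) (a b c e r t C D : R).

Definition log_equicontinuous (L : (X -> R) -> X -> R) :=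
  forall g, continuous g -> (forall x, 0 < g x) -> forall e, 0 < e ->
    exists2 r, 0 < r & forall x y, ball x r y ->
      forall n, iter n L g x <= (1 + e) * iter n L g y.

Definition ball_minorized (L : (X -> R) -> X -> R) :=
  forall r, 0 < r -> exists k, exists2 c, 0 < c &
    forall y g t, continuous g -> (forall x, 0 <= g x) -> 0 <= t ->
      (forall z, ball y r z -> t <= g z) -> forall x, c * t <= iter k L g x.

Hypothesis Xc : compact [set: X].
Variable L : (X -> R) -> X -> R.
Hypothesis Lpos : positive_operator L.
Hypothesis L1_gt0 : forall x, 0 < L (fun=> 1) x.
Hypothesis L_log_equicontinuous : log_equicontinuous L.
Hypothesis L_minorized : ball_minorized L.

Let Ln_pos n : positive_operator (iter n L).
Proof. exact: positive_operator_iter. Qed.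

Let Ln_cts n g : continuous g -> continuous (iter n L g).
Proof. exact: (Ln_pos n).1. Qed.

Let cst_cts c : continuous (fun=> c : R) := @cst_continuous X R c.

Local Notation u n := (iter n L (fun=> 1)).

Let u_cts n : continuous (u n). Proof. exact: Ln_cts. Qed.

Lemma orbit1_gt0 n x : 0 < u n x.
Proof.
elim: n x => [|n IH] x; first exact: ltr01.
have [c c0 cu] := compact_continuous_gt0 Xc (@u_cts n) IH.
apply: (@lt_le_trans _ _ (L (fun=> c) x)).
  by rewrite positive_operator_cst// mulr_gt0.
exact: (positive_operator_le Lpos (@cst_cts c) (@u_cts n) cu).
Qed.
Hint Resolve orbit1_gt0 : core.

Definition ratio n g x := iter n L g x / u n x.

Lemma iter_ratio n g x : iter n L g x = ratio n g x * u n x.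
Proof. by rewrite /ratio divfK// gt_eqF. Qed.

Lemma ratio_positive n : positive_operator (ratio n).
Proof.
split=> [g gc x|x].
  by apply: cvgM (cvgV _ (@u_cts n x)); [exact: Ln_cts|rewrite gt_eqF].
split=> [a g h gc hc|g gc g0]; rewrite /ratio.
  by rewrite ((Ln_pos n).2 x).1// mulrDl mulrA.
by apply: divr_ge0; [exact: ((Ln_pos n).2 x).2 _ gc g0|exact: ltW].
Qed.

Lemma ratio_cst n c x : ratio n (fun=> c) x = c.
Proof.
rewrite (positive_operator_cst (ratio_positive n)) /ratio.
by rewrite divff ?mulr1// gt_eqF.
Qed.

Lemma ratio_subr n g c x : continuous g ->
  ratio n (fun y => g y - c) x = ratio n g x - c.
Proof.
by move=> gc; rewrite (positive_operatorB (ratio_positive n))// ratio_cst.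
Qed.

Lemma ratio_subl n g c x : continuous g ->
  ratio n (fun y => c - g y) x = c - ratio n g x.
Proof.
by move=> gc; rewrite (positive_operatorB (ratio_positive n))// ratio_cst.
Qed.

Lemma ratio_le n g b : continuous g -> (forall x, g x <= b) ->
  forall x, ratio n g x <= b.
Proof.
move=> gc gb x.
by rewrite -(ratio_cst n b x) (positive_operator_le (ratio_positive n)).
Qed.

Lemma ratio_ge n g a : continuous g -> (forall x, a <= g x) ->
  forall x, a <= ratio n g x.
Proof.
move=> gc ga x.
by rewrite -(ratio_cst n a x) (positive_operator_le (ratio_positive n)).
Qed.

Lemma ratio_iter_bounds n g a b : continuous g ->
  (forall x, a <= ratio n g x <= b) ->
  forall m x, a <= ratio (m + n) g x <= b.
Proof.
move=> gc gab m x; rewrite /ratio ler_pdivlMr// ler_pdivrMr// !iterD.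
rewrite -!(positive_operatorZ (Ln_pos m))//.
have [gnc uc] := (@Ln_cts n g gc, fun c => continuous_scale c (@u_cts n)).
apply/andP; split; apply: (positive_operator_le (Ln_pos m)) => // y.
  by have /andP[+ _] := gab y; rewrite ler_pdivlMr.
by have /andP[_] := gab y; rewrite ler_pdivrMr.
Qed.

Let orbit1_near : exists2 r, 0 < r & forall x y, ball x r y ->
  forall n, u n x <= 2 * u n y.
Proof.
have [r r0 ur] := L_log_equicontinuous (@cst_cts 1) (fun=> ltr01) ltr01.
by exists r.
Qed.

Let orbit1_harnack_at n :
  exists2 D, 0 < D & forall x y, u n x <= D * u n y.
Proof.
have [c c0 cu] := compact_continuous_gt0 Xc (@u_cts n) (orbit1_gt0 n).
have [C C0 uC] := compact_continuous_bounded Xc (@u_cts n).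
exists (C / c) => [|x y]; first by rewrite divr_gt0.
rewrite mulrAC ler_pdivlMr//.
apply: ler_pM (ltW (orbit1_gt0 n x)) (ltW c0) _ (cu y).
exact: le_trans (ler_norm _) (uC x).
Qed.

Let orbit1_harnack_lt N :
  exists2 D, 0 < D & forall n x y, (n < N)%N -> u n x <= D * u n y.
Proof.
elim: N => [|N [D D0 uD]]; first by exists 1.
have [D' D'0 uD'] := orbit1_harnack_at N; exists (D + D');
  first exact: addr_gt0.
move=> n x y; rewrite ltnS leq_eqVlt mulrDl => /predU1P[->|nN].
  by rewrite ler_wpDl// mulr_ge0// ltW.
by rewrite ler_wpDr ?uD// mulr_ge0// ltW.
Qed.

(* Minorization spreads the value of [u n] at a point to all of [u (k + n)]. *)
Lemma orbit1_harnack : exists2 D, 0 < D & forall n x y, u n x <= D * u n y.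
Proof.
have [r r0 ur] := orbit1_near; have [k [c c0 Lk]] := L_minorized r0.
have [C C0 uC] := compact_continuous_bounded Xc (@u_cts k).
have [D D0 uD] := orbit1_harnack_lt k.
have spread n x y : u n x <= 2 / c * u (k + n) y.
  rewrite iterD mulrAC ler_pdivlMr// mulrC -ler_pdivrMl// mulrCA.
  apply: (Lk x) => // [z||z xz]; first exact: ltW.
    by rewrite mulr_ge0// ltW.
  by rewrite ler_pdivrMl// ur.
exists (D + 2 / c * C) => [|n x y];
  first by rewrite addr_gt0// mulr_gt0// divr_gt0.
rewrite mulrDl; have [nk|/subnKC <-] := ltnP n k.
  by rewrite ler_wpDr ?uD// !mulr_ge0// ?invr_ge0 ltW.
rewrite ler_wpDl ?mulr_ge0 ?(ltW D0) ?(ltW (orbit1_gt0 _ _))//.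
set m := (n - k)%N; apply: (@le_trans _ _ (2 / c * u (k + m) y * u k x)).
  rewrite [in leLHS]iterD -(positive_operator_cst (Ln_pos k)).
  by apply: (positive_operator_le (Ln_pos k)) => // z; exact: spread.
rewrite mulrAC; apply: ler_wpM2r; first exact: ltW.
by rewrite ler_pM2l ?divr_gt0// (le_trans (ler_norm _)).
Qed.

Lemma ratio_minorized r : 0 < r -> exists k, exists2 c, 0 < c &
  forall n g t y, continuous g -> (forall x, 0 <= ratio n g x) -> 0 <= t ->
    (forall z, ball y r z -> t <= ratio n g z) ->
  forall x, c * t <= ratio (k + n) g x.
Proof.
move=> r0; have [s s0 us] := orbit1_near; have [D D0 uD] := orbit1_harnack.
have rs0 : 0 < Num.min r s by rewrite lt_min r0.
have [k [c c0 Lk]] := L_minorized rs0.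
have [C C0 uC] := compact_continuous_bounded Xc (@u_cts k).
exists k, (c / (2 * D * C)) => [|n g t y gc g0 t0 gt x].
  by rewrite divr_gt0// !mulr_gt0.
have ukn : u (k + n) x <= D * u n y * C.
  rewrite iterD; apply: (@le_trans _ _ (D * u n y * u k x)).
    rewrite -(positive_operator_cst (Ln_pos k)).
    by apply: (positive_operator_le (Ln_pos k)) => // z; exact: uD.
  by apply: ler_wpM2l (le_trans (ler_norm _) (uC x)); rewrite mulr_ge0// ltW.
rewrite ler_pdivlMr//; apply: (@le_trans _ _ (c * (t * u n y / 2))).
  apply: (@le_trans _ _ (c / (2 * D * C) * t * (D * u n y * C))).
    by apply: ler_wpM2l ukn; rewrite mulr_ge0// ltW// divr_gt0// !mulr_gt0.
  by rewrite le_eqVlt; apply/orP; left; apply/eqP; field; rewrite !gt_eqF.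
rewrite [in leRHS]iterD; apply: (Lk y) => [|z||z yz].
- exact: Ln_cts.
- by rewrite iter_ratio mulr_ge0// ltW.
- by rewrite !mulr_ge0// ltW.
- rewrite (iter_ratio n g z) ler_pdivrMr// -mulrA [_ * 2]mulrC.
  apply: ler_pM t0 (ltW (orbit1_gt0 n y)) _ _.
    by apply: gt; apply: le_ball yz; rewrite ge_min lexx.
  by apply: us; apply: le_ball yz; rewrite ge_min lexx orbT.
Qed.

(* Whichever half of the interval contains the value of the ratio at one point,
   minorization moves the opposite end point. *)
Lemma ratio_contracts r e : 0 < r -> 0 < e -> exists k, exists2 q, 0 <= q < 1 &
  forall n g a b, continuous g ->
    (forall x y, ball x r y -> `|ratio n g x - ratio n g y| <= e) ->
    2 * e <= b - a -> (forall x, a <= ratio n g x <= b) ->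
  exists a' b', (forall x, a' <= ratio (k + n) g x <= b') /\
    b' - a' - 2 * e = q * (b - a - 2 * e).
Proof.
move=> r0 e0; have [k [c c0 rk]] := ratio_minorized r0.
have c_le1 : c <= 1.
  have := rk 0%N (fun=> 1) 1 point (@cst_cts 1) _ ler01 _ point.
  by rewrite !ratio_cst mulr1; apply => // x; rewrite ratio_cst.
exists k, (1 - c / 2) => [|n g a b gc g_osc ab gab].
  by apply/andP; split; lra.
have kab := ratio_iter_bounds gc gab k.
pose t := (b - a) / 2 - e; have t0 : 0 <= t by rewrite /t; lra.
have near_point z : ball point r z ->
    ratio n g point - e <= ratio n g z <= ratio n g point + e.
  by move=> /g_osc; rewrite ler_norml => /andP[? ?]; apply/andP; split; lra.
have [low|high] := lerP (ratio n g point) ((a + b) / 2).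
- exists a, (b - c * t); split; last by rewrite /t; lra.
  move=> x; have /andP[-> _] := kab x.
  rewrite /= lerBrDr -lerBrDl -ratio_subl//.
  apply: (rk _ _ _ point) => // [y|y|y /near_point/andP[_ ?]];
    rewrite ?ratio_subl//.
  + exact: cvgB (cvg_cst _) (gc y).
  + by have /andP[_] := gab y; rewrite subr_ge0.
  + by rewrite /t; lra.
- exists (a + c * t), b; split; last by rewrite /t; lra.
  move=> x; have /andP[_ ->] := kab x; rewrite andbT -lerBrDl -ratio_subr//.
  apply: (rk _ _ _ point) => // [y|y|y /near_point/andP[? _]];
    rewrite ?ratio_subr//.
  + exact: cvgB (gc y) (cvg_cst _).
  + by have /andP[+ _] := gab y; rewrite subr_ge0.
  + by rewrite /t; lra.
Qed.

(* [N] may not depend on [g]: this is what makes the convergence uniform over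
   the functions [density m] below. *)
Lemma ratio_concentrates r e w : 0 < r -> 0 < e -> exists N, forall g a b,
    continuous g ->
    (forall n x y, ball x r y -> `|ratio n g x - ratio n g y| <= e) ->
    (forall x, a <= g x <= b) -> b - a <= w ->
  exists a' b', b' - a' <= 3 * e /\
    forall n, (N <= n)%N -> forall x, a' <= ratio n g x <= b'.
Proof.
move=> r0 e0; have [k [q /andP[q0 q1] shrink]] := ratio_contracts r0 e0.
have [j qj] : exists j, q ^+ j * `|w| <= e.
  have : q ^+ j * `|w| @[j --> \oo] --> 0 * `|w|.
    by apply: cvgMr_tmp; apply: cvg_expr; rewrite ger0_norm.
  rewrite mul0r => /cvgrPdist_le/(_ e e0)[j _ /(_ j (leqnn j))].
  by rewrite sub0r normrN ger0_norm ?mulr_ge0 ?exprn_ge0// => ?; exists j.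
exists (j * k)%N => g a b gc gr gab abw.
suff [a' [b' [ab' gab']]] : exists a' b', b' - a' - 2 * e <= q ^+ j * `|w| /\
    forall x, a' <= ratio (j * k) g x <= b'.
  exists a', b'; split; first lra.
  by move=> n /subnK <- x; exact: ratio_iter_bounds.
elim: j {qj} => [|j [a' [b' [ab' gab']]]].
  exists a, b; split; first by have := ler_norm w; lra.
  by move=> x; rewrite ratio_ge ?ratio_le// => y; have /andP[] := gab y.
have [wide|narrow] := lerP (2 * e) (b' - a').
  have [lo [hi [g_lo_hi width]]] := shrink _ _ _ _ gc (gr _) wide gab'.
  by exists lo, hi; rewrite mulSn width exprS -mulrA ler_wpM2l.
exists a', b'; split; last by move=> x; rewrite mulSn; exact: ratio_iter_bounds.
by apply: (@le_trans _ _ 0); [lra|rewrite mulr_ge0// exprn_ge0].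
Qed.

Lemma ratio_dist_near n g r e C : 0 < e <= 1 ->
  (forall x, 0 <= ratio n g x <= C) ->
  (forall x y, ball x r y -> iter n L g x <= (1 + e) * iter n L g y) ->
  (forall x y, ball x r y -> u n x <= (1 + e) * u n y) ->
  forall x y, ball x r y -> `|ratio n g x - ratio n g y| <= 3 * e * C.
Proof.
move=> /andP[e0 e1] gC gr ur.
have one_sided x y : ball x r y -> ratio n g x - ratio n g y <= 3 * e * C.
  move=> xy; have /andP[g0 gyC] := gC y; have u0 := orbit1_gt0 n x.
  rewrite lerBlDr -(ler_pM2r u0) -iter_ratio (le_trans (gr x y xy))//.
  rewrite iter_ratio mulrCA; have uyx := ur y x (ball_sym xy).
  apply: (@le_trans _ _ (ratio n g y * ((1 + e) * ((1 + e) * u n x)))).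
    by rewrite ler_wpM2l// ler_wpM2l// addr_ge0// ltW.
  have eqC : e * ratio n g y <= e * C by rewrite ler_pM2l.
  have eeq : e * (e * ratio n g y) <= e * ratio n g y.
    by rewrite ler_piMl// mulr_ge0// ltW.
  by rewrite !mulrA ler_pM2r//; lra.
by move=> x y xy; rewrite ler_norml lerNl opprB !one_sided//; exact: ball_sym.
Qed.

Let ratio_modulus B e : 0 < B -> 0 < e -> exists s r, [/\ 0 < s, 0 < r &
  forall n g t, continuous g -> (forall x, 0 <= g x <= B) -> t <= r ->
    (forall x y, ball x t y -> iter n L g x <= (1 + s) * iter n L g y) ->
  forall x y, ball x t y -> `|ratio n g x - ratio n g y| <= e].
Proof.
move=> B0 e0; pose s := Num.min 1 (e / (3 * B)).
have s0 : 0 < s by rewrite lt_min ltr01 divr_gt0// mulr_gt0.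
have [r r0 ur] := L_log_equicontinuous (@cst_cts 1) (fun=> ltr01) s0.
exists s, r; split=> // n g t gc gB tr gt x y xy.
apply: (@le_trans _ _ (3 * s * B)).
  apply: (ratio_dist_near _ _ gt _ xy) => [|z|z z' /(le_ball tr)/ur//].
    by rewrite s0 ge_min lexx.
  by rewrite ratio_ge ?ratio_le// => z'; case/andP: (gB z').
by rewrite mulrAC -ler_pdivlMl ?mulr_gt0// mulrC ge_min lexx orbT.
Qed.

Lemma ratio_equicontinuous g : continuous g -> forall e, 0 < e ->
  exists2 r, 0 < r & forall n x y, ball x r y ->
    `|ratio n g x - ratio n g y| <= e.
Proof.
move=> gc e e0; have [C C0 gC] := compact_continuous_bounded Xc gc.
pose c := - (C + 1); pose shifted x := g x - c; pose B := 2 * C + 1.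
have shifted_cts : continuous shifted.
  by move=> x; exact: cvgB (gc x) (cvg_cst _).
have shiftedB x : 0 < shifted x <= B.
  have := gC x; rewrite ler_norml => /andP[? ?].
  by apply/andP; split; rewrite /shifted /c /B; lra.
have B0 : 0 < B by rewrite /B; lra.
have [s [r [s0 r0 ratior]]] := ratio_modulus B0 e0.
have [|t t0 gt] := L_log_equicontinuous shifted_cts _ s0.
  by move=> x; case/andP: (shiftedB x).
exists (Num.min r t) => [|n x y xy]; first by rewrite lt_min r0.
have -> : ratio n g x - ratio n g y = ratio n shifted x - ratio n shifted y.
  by rewrite !ratio_subr// opprB addrA subrK.
apply: (ratior _ _ _ shifted_cts _ _ _ _ _ xy) => [z||z z' zz'].
- by have /andP[/ltW ->] := shiftedB z.
- by rewrite ge_min lexx.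
- by apply: gt; apply: le_ball zz'; rewrite ge_min lexx orbT.
Qed.

Definition eigenfunctional g := limn (fun n => ratio n g point).

Lemma cvg_eigenfunctional g : continuous g ->
  ratio n g point @[n --> \oo] --> eigenfunctional g.
Proof.
move=> gc; apply: cauchy_cvg; apply: cauchy_exP => e e0.
have e60 : 0 < e / 6 by rewrite divr_gt0.
have [r r0 gr] := ratio_equicontinuous gc e60.
have [C C0 gC] := compact_continuous_bounded Xc gc.
have [N ratioN] := ratio_concentrates (C + C) r0 e60.
have [x||a [b [ab gab]]] := ratioN g (- C) C gc gr.
- by rewrite -ler_norml.
- by rewrite opprK.
exists (ratio N g point); exists N => // n /= Nn; rewrite /ball/=.
have /andP[? ?] := gab N (leqnn N) point; have /andP[? ?] := gab n Nn point.
by rewrite ltr_norml; apply/andP; split; lra.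
Qed.

Lemma ratio_near_eigenfunctional r e w : 0 < r -> 0 < e ->
  exists N, forall g a b, continuous g ->
    (forall n x y, ball x r y -> `|ratio n g x - ratio n g y| <= e) ->
    (forall x, a <= g x <= b) -> b - a <= w ->
  forall n, (N <= n)%N -> forall x, `|ratio n g x - eigenfunctional g| <= 3 * e.
Proof.
move=> r0 e0; have [N ratioN] := ratio_concentrates w r0 e0.
exists N => g a b gc gr gab abw n Nn x.
have [a' [b' [ab' gab']]] := ratioN g a b gc gr gab abw.
have /andP[? ?] : a' <= eigenfunctional g <= b'.
  have gcvg : cvgn (fun k => ratio k g point).
    by apply/cvg_ex; exists (eigenfunctional g); exact: cvg_eigenfunctional.
  by apply/andP; split; [apply: limr_ge|apply: limr_le] => //;
    exists N => // k /= Nk; have /andP[] := gab' k Nk point.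
have /andP[? ?] := gab' n Nn x.
by rewrite ler_norml; apply/andP; split; lra.
Qed.

Lemma ratio_cvg_uniform g : continuous g -> forall e, 0 < e ->
  exists N, forall n, (N <= n)%N -> forall x,
    `|ratio n g x - eigenfunctional g| <= e.
Proof.
move=> gc e e0; have e30 : 0 < e / 3 by rewrite divr_gt0.
have [r r0 gr] := ratio_equicontinuous gc e30.
have [C C0 gC] := compact_continuous_bounded Xc gc.
have [N ratioN] := ratio_near_eigenfunctional (C + C) r0 e30.
exists N => n Nn x; rewrite (_ : e = 3 * (e / 3)); last by field.
by apply: (ratioN g (- C) C) => // [y|]; rewrite ?opprK// -ler_norml.
Qed.

Lemma eigenfunctional_positive : positive_functional eigenfunctional.
Proof.
split=> [a g h gc hc|g gc g0].
  apply: cvg_lim => //.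
  under eq_fun do rewrite ((ratio_positive _).2 point).1//.
  by apply: cvgD; [apply: cvgMl_tmp|]; exact: cvg_eigenfunctional.
apply: limr_ge; last by apply: nearW => n; exact: ratio_ge.
by apply/cvg_ex; exists (eigenfunctional g); exact: cvg_eigenfunctional.
Qed.

Lemma eigenfunctional_cst c : eigenfunctional (fun=> c) = c.
Proof.
by apply: cvg_lim => //; under eq_fun do rewrite ratio_cst; exact: cvg_cst.
Qed.

Definition eigenvalue := eigenfunctional (L (fun=> 1)).

Lemma eigenfunctionalL g : continuous g ->
  eigenfunctional (L g) = eigenvalue * eigenfunctional g.
Proof.
move=> gc; have L1c : continuous (L (fun=> 1)) by exact: Lpos.1.
rewrite mulrC; apply: cvg_lim => //.
have -> : (fun n => ratio n (L g) point) =
    (fun n => ratio n.+1 g point * ratio n (L (fun=> 1)) point).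
  by apply/funext => n; rewrite /ratio -!iterSr mulrA divfK// gt_eqF.
apply: cvgM (cvg_eigenfunctional L1c).
by rewrite (cvg_shiftS (fun n => ratio n g point)); exact: cvg_eigenfunctional.
Qed.

Lemma eigenfunctional_iter n g : continuous g ->
  eigenfunctional (iter n L g) = eigenvalue ^+ n * eigenfunctional g.
Proof.
move=> gc; elim: n => [|n IH]; first by rewrite mul1r.
by rewrite iterS eigenfunctionalL ?IH ?exprS ?mulrA//; exact: Ln_cts.
Qed.

Lemma eigenvalue_gt0 : 0 < eigenvalue.
Proof.
have L1c : continuous (L (fun=> 1)) by exact: Lpos.1.
have [c c0 cL] := compact_continuous_gt0 Xc L1c L1_gt0.
rewrite (lt_le_trans c0)// -(eigenfunctional_cst c).
exact: (positive_functional_le eigenfunctional_positive).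
Qed.

Definition density n x := eigenvalue ^- n * u n x.

Lemma density_bounds : exists2 D, 0 < D & forall n x,
  D^-1 <= density n x <= D.
Proof.
have [D D0 uD] := orbit1_harnack; exists D => // n x.
have lam0 : 0 < eigenvalue ^+ n by rewrite exprn_gt0// eigenvalue_gt0.
have lamE : eigenfunctional (u n) = eigenvalue ^+ n.
  by rewrite eigenfunctional_iter// eigenfunctional_cst mulr1.
have lpos := eigenfunctional_positive.
rewrite /density ler_pdivrMl// ler_pdivlMl// -lamE; apply/andP; split.
  rewrite ler_pdivrMr// mulrC -[leRHS]eigenfunctional_cst.
  by apply: (positive_functional_le lpos) => // y; exact: uD.
rewrite mulrC -(positive_functionalZ lpos)// -[leLHS]eigenfunctional_cst.
by apply: (positive_functional_le lpos (@cst_cts _)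
  (continuous_scale D (@u_cts n))).
Qed.

Lemma density_gt0 n x : 0 < density n x.
Proof. by rewrite mulr_gt0// invr_gt0 exprn_gt0// eigenvalue_gt0. Qed.
Hint Resolve density_gt0 : core.

Let density_cts n : continuous (density n).
Proof. exact: continuous_scale. Qed.

Lemma densityL n x : L (density n) x = eigenvalue * density n.+1 x.
Proof.
rewrite positive_operatorZ// /density exprS invfM mulrA.
by rewrite mulVKf// gt_eqF// eigenvalue_gt0.
Qed.

Lemma densityD n m x : density (n + m) x = density n x * ratio n (density m) x.
Proof.
rewrite (positive_operatorZ (ratio_positive n))// /density exprD invfM iterD.
by rewrite iter_ratio; ring.
Qed.

Let density_ratio_equicontinuous e : 0 < e -> exists2 r, 0 < r &
  forall m n x y, ball x r y ->
    `|ratio n (density m) x - ratio n (density m) y| <= e.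
Proof.
move=> e0; have [D D0 uD] := density_bounds.
have [s [r [s0 r0 ratior]]] := ratio_modulus D0 e0.
have [t t0 ut] := L_log_equicontinuous (@cst_cts 1) (fun=> ltr01) s0.
have l0 : 0 < eigenvalue := eigenvalue_gt0.
exists (Num.min r t) => [|m n x y xy]; first by rewrite lt_min r0.
apply: (ratior _ _ _ (@density_cts m) _ _ _ _ _ xy) => [z||z z' zz'].
- by have /andP[_ ->] := uD m z; rewrite andbT ltW.
- by rewrite ge_min lexx.
- rewrite !(positive_operatorZ (Ln_pos n))// mulrCA.
  rewrite ler_pM2l ?invr_gt0 ?exprn_gt0//.
  by rewrite -!iterD; apply: ut; apply: le_ball zz'; rewrite ge_min lexx orbT.
Qed.

(* By [densityD], consecutive densities differ by ratios of the functions
   [density m], which concentrate at 1 uniformly in [m]. *)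
Lemma density_cauchy e : 0 < e -> exists N, forall n, (N <= n)%N ->
  forall m x, `|density (n + m) x - density n x| <= e.
Proof.
move=> e0; have [D D0 uD] := density_bounds.
have s0 : 0 < e / (3 * D) by rewrite divr_gt0// mulr_gt0.
have [r r0 dr] := density_ratio_equicontinuous s0.
have [N ratioN] := ratio_near_eigenfunctional D r0 s0.
exists N => n Nn m x.
have dD k y : density k y <= D by have /andP[] := uD k y.
have dm1 : eigenfunctional (density m) = 1.
  rewrite (positive_functionalZ eigenfunctional_positive)//.
  rewrite eigenfunctional_iter// eigenfunctional_cst mulr1 mulVf//.
  by rewrite expf_neq0// gt_eqF// eigenvalue_gt0.
have := ratioN _ 0 D (@density_cts m) (dr m) _ _ n Nn x.
rewrite dm1 subr0 => /(_ _ (lexx D)) ratio1.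
rewrite densityD -[X in _ - X]mulr1 -mulrBr normrM gtr0_norm//.
rewrite (_ : e = D * (3 * (e / (3 * D)))); last by field; rewrite gt_eqF.
by apply: ler_pM => //; [exact: ltW|apply: ratio1 => y; rewrite dD ltW].
Qed.

Definition eigenfunction x := limn (density ^~ x).

Let cvg_density x : density n x @[n --> \oo] --> eigenfunction x.
Proof.
apply: cauchy_cvg; apply: cauchy_exP => e e0.
have e20 : 0 < e / 2 by rewrite divr_gt0.
have [N dN] := density_cauchy e20.
exists (density N x); exists N => // n /= /subnKC <-; rewrite /ball /= distrC.
by apply: le_lt_trans (dN N (leqnn N) _ x) _; rewrite gtr_pMr// invf_lt1 ?ltr1n.
Qed.

Lemma density_cvg_uniform e : 0 < e -> exists N, forall n, (N <= n)%N ->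
  forall x, `|density n x - eigenfunction x| <= e.
Proof.
move=> e0; have [N dN] := density_cauchy e0; exists N => n Nn x.
rewrite distrC; have : `|density (m + n) x - density n x| @[m --> \oo] -->
    `|eigenfunction x - density n x|.
  apply: cvg_norm; apply: cvgB (cvg_cst _).
  by rewrite (cvg_shiftn n (density ^~ x)); exact: cvg_density.
move=> dist_cvg; rewrite -(cvg_lim _ dist_cvg)//; apply: limr_le.
  by apply/cvg_ex; exists `|eigenfunction x - density n x|.
by apply: nearW => m; rewrite addnC dN.
Qed.

Lemma eigenfunction_continuous : continuous eigenfunction.
Proof.
move=> x; apply/cvgrPdist_le => e e0.
have e30 : 0 < e / 3 by rewrite divr_gt0.
have [N /(_ N (leqnn N)) dN] := density_cvg_uniform e30.
have /cvgrPdist_le/(_ _ e30) := @density_cts N x.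
apply: filterS => y; have := dN x; have := dN y; rewrite !ler_norml.
by move=> /andP[? ?] /andP[? ?] /andP[? ?]; apply/andP; split; lra.
Qed.

Lemma eigenfunction_gt0 x : 0 < eigenfunction x.
Proof.
have [D D0 uD] := density_bounds; apply: (@lt_le_trans _ _ D^-1).
  by rewrite invr_gt0.
apply: limr_ge; last by apply: nearW => n; have /andP[] := uD n x.
by apply/cvg_ex; exists (eigenfunction x); exact: cvg_density.
Qed.

Lemma eigenfunctionL x : L eigenfunction x = eigenvalue * eigenfunction x.
Proof.
have Ldensity : L (density n) x @[n --> \oo] --> L eigenfunction x.
  apply/cvgrPdist_le => e e0.
  have e10 : 0 < e / L (fun=> 1) x by rewrite divr_gt0.
  have [N dN] := density_cvg_uniform e10; exists N => // n /= Nn.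
  rewrite distrC -[leRHS](divfK (lt0r_neq0 (L1_gt0 x))).
  apply: (positive_functional_dist (Lpos.2 x)) => //.
    exact: eigenfunction_continuous.
  exact: dN.
apply: cvg_unique Ldensity _ => //.
rewrite (_ : (fun n => _) = fun n => eigenvalue * density n.+1 x).
  by apply: cvgMl_tmp; rewrite (cvg_shiftS (density ^~ x)); exact: cvg_density.
by apply/funext => n; exact: densityL.
Qed.

Lemma normalized_iter_cvg_uniform g : continuous g -> forall e, 0 < e ->
  exists N, forall n, (N <= n)%N -> forall x,
  `|eigenvalue ^- n * iter n L g x - eigenfunction x * eigenfunctional g| <= e.
Proof.
move=> gc e e0; have [D D0 uD] := density_bounds.
pose c := `|eigenfunctional g| + 1; have c0 : 0 < c by rewrite ltr_wpDl.
have eD0 : 0 < e / 2 / D by rewrite !divr_gt0.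
have ec0 : 0 < e / 2 / c by rewrite !divr_gt0.
have [Nratio ratioN] := ratio_cvg_uniform gc eD0.
have [Ndensity dN] := density_cvg_uniform ec0.
exists (maxn Nratio Ndensity) => n.
rewrite geq_max => /andP[ratio_n density_n] x.
have -> : eigenvalue ^- n * iter n L g x - eigenfunction x * eigenfunctional g =
    density n x * (ratio n g x - eigenfunctional g) +
    (density n x - eigenfunction x) * eigenfunctional g.
  by rewrite iter_ratio /density; ring.
rewrite (le_trans (ler_normD _ _))// [leRHS]splitr lerD// normrM.
  rewrite -[leRHS](divfK (lt0r_neq0 D0)) mulrC ler_pM ?ratioN// gtr0_norm//.
  by have /andP[] := uD n x.
by rewrite -[leRHS](divfK (lt0r_neq0 c0)) ler_pM ?dN// lerDl.
Qed.

Lemma eigenfunctional_unique l : positive_functional l -> l (fun=> 1) = 1 ->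
  (forall g, continuous g -> l (L g) = eigenvalue * l g) ->
  forall g, continuous g -> l g = eigenfunctional g.
Proof.
move=> lpos l1 lL.
have lam0 n : eigenvalue ^+ n != 0.
  by rewrite expf_neq0// gt_eqF// eigenvalue_gt0.
have lLn n g : continuous g -> l (iter n L g) = eigenvalue ^+ n * l g.
  move=> gc; elim: n => [|n IH]; first by rewrite mul1r.
  by rewrite iterS lL ?IH ?exprS ?mulrA//; exact: Ln_cts.
have l_eigenfunctional g : continuous g ->
    l g = l eigenfunction * eigenfunctional g.
  move=> gc; apply/eqP; rewrite -subr_eq0 -normr_le0.
  apply/ler_addgt0Pr => e.
  move=> /(normalized_iter_cvg_uniform gc)[N /(_ N (leqnn N)) gN].
  rewrite add0r -[e in leRHS]mulr1 -[in leRHS]l1 [X in _ - X]mulrC.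
  have lnZ := positive_functionalZ lpos (eigenvalue ^- N) (@Ln_cts N g gc).
  rewrite -(positive_functionalZ lpos _ eigenfunction_continuous).
  rewrite lLn// mulKf// in lnZ; rewrite -lnZ.
  apply: (positive_functional_dist lpos) => [||x].
  - by apply: continuous_scale; exact: Ln_cts.
  - by apply: continuous_scale; exact: eigenfunction_continuous.
  - by rewrite [X in _ - X]mulrC.
move=> g gc; rewrite l_eigenfunctional// (_ : l eigenfunction = 1) ?mul1r//.
by have := l_eigenfunctional _ (@cst_cts 1);
  rewrite l1 eigenfunctional_cst mulr1.
Qed.

Definition perron_frobenius (lam : R) (h : X -> R)
    (P : probability (g_sigma_algebraType (@open X)) R) :=
  [/\ 0 < lam, continuous h /\ (forall x, 0 < h x),
      (forall x, L h x = lam * h x) /\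
      (forall g, continuous g -> \int[P]_x L g x = lam * \int[P]_x g x),
      (forall g, continuous g -> forall e, 0 < e -> exists N, forall n,
        (N <= n)%N -> forall x,
        `|lam ^- n * iter n L g x - h x * \int[P]_y g y| <= e) &
      (forall P' : probability (g_sigma_algebraType (@open X)) R,
        (forall g, continuous g -> \int[P']_x L g x = lam * \int[P']_x g x) ->
        forall A : set (g_sigma_algebraType (@open X)),
          measurable A -> P' A = P A)].

Theorem ruelle_perron_frobenius : exists lam h P, perron_frobenius lam h P.
Proof.
have [P PE] :=
  riesz_representation eigenfunctional_positive Xc (eigenfunctional_cst 1).
exists eigenvalue, eigenfunction, P; split.
- exact: eigenvalue_gt0.
- by split; [exact: eigenfunction_continuous|exact: eigenfunction_gt0].
- split=> [x|g gc]; first exact: eigenfunctionL.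
  by rewrite !PE ?eigenfunctionalL//; exact: Lpos.1.
- by move=> g gc; rewrite PE//; exact: normalized_iter_cvg_uniform.
- move=> P' P'L; apply: finite_measure_unique => g gc; rewrite PE//.
  apply: (eigenfunctional_unique (l := fun g => \int[P']_x g x)) => //.
    exact: Rintegral_borel_positive_functional.
  by rewrite Rintegral_cst// mul1r [X in fine X](probability_setT P').
Qed.

End PerronFrobenius.

(** * The sequence space *)

Section Words.
Variables (R : realType) (M : pointedType) (f : (nat -> M) -> R).
Implicit Types (n : nat) (w x : nat -> M) (a : M).

Lemma pword0 w x : pword 0 w x = x.
Proof. by apply/funext => k; rewrite /pword subn0. Qed.

Lemma pword_rcons n w a x :
  pword n w (pcons a x) = pword n.+1 (fun k => if (k < n)%N then w k else a) x.
Proof.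
apply/funext => k; rewrite /pword ltnS; case: ltngtP => // [nk|->].
  by rewrite -(subnSK nk).
by rewrite subnn.
Qed.

Lemma iter_shiftE n x : iter n (@Defs.shift M) x = fun k => x (k + n)%N.
Proof.
elim: n x => [|n IH] x; first by apply/funext => k; rewrite addn0.
by rewrite iterS IH; apply/funext => k; rewrite /Defs.shift addnS.
Qed.

Lemma iter_shift_pword n w x : iter n (@Defs.shift M) (pword n w x) = x.
Proof.
by rewrite iter_shiftE; apply/funext => k; rewrite /pword addnK ltnNge leq_addl.
Qed.

Lemma SsumS_pword n w x :
  Ssum f n.+1 (pword n w x) = Ssum f n (pword n w x) + f x.
Proof. by rewrite /Ssum big_ord_recr /= iter_shift_pword. Qed.

End Words.

Section OmegaMetric.
Variables (R : realType) (M : pointedType) (d : M -> M -> R).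
Hypothesis dm : is_metric d.
Hypothesis d_bounded : exists2 C : R, 0 < C & forall a b, d a b <= C.
Implicit Types (x y z w : nat -> M) (a b : M).

Let d_ge0 a b : 0 <= d a b. Proof. by case: dm. Qed.

Let d_refl a : d a a = 0.
Proof. by case: dm => _ d0 _ _; exact: (d0 a a).2. Qed.

Let psum x y N : R := \sum_(0 <= n < N) (2 ^- n.+1 * d (x n) (y n)).

Let psumS x y N : psum x y N.+1 =
  1 / 2 * d (x 0%N) (y 0%N) + 1 / 2 * psum (Defs.shift x) (Defs.shift y) N.
Proof.
rewrite /psum big_nat_recl// expr1 div1r; congr (_ + _).
by rewrite mulr_sumr; apply: eq_bigr => i _; rewrite exprS invfM mulrA.
Qed.

Let psum_nondecreasing x y : nondecreasing_seq (psum x y).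
Proof.
apply/nondecreasing_seqP => n; rewrite /psum big_nat_recr//= lerDl.
by rewrite mulr_ge0// invr_ge0 exprn_ge0.
Qed.

Let psum_le C x y N : 0 <= C -> (forall a b, d a b <= C) -> psum x y N <= C.
Proof.
move=> C0 dC; elim: N x y => [|N IH] x y; first by rewrite /psum big_geq.
rewrite psumS.
by have := dC (x 0%N) (y 0%N); have := IH (Defs.shift x) (Defs.shift y); lra.
Qed.

Let cvg_psum x y : psum x y @ \oo --> dOmega d x y.
Proof.
have [C C0 dC] := d_bounded; apply: nondecreasing_is_cvgn.
  exact: psum_nondecreasing.
by exists C => _ [n _ <-]; exact: psum_le (ltW C0) dC.
Qed.

Let psum_le_dOmega x y n : psum x y n <= dOmega d x y.
Proof.
by apply: nondecreasing_cvgn_le; [exact: psum_nondecreasing|exact: cvg_psum].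
Qed.

Let dOmega_le x y C : (forall n, psum x y n <= C) -> dOmega d x y <= C.
Proof. by move=> xyC; apply: limr_le; [exact: cvg_psum|exact: nearW]. Qed.

Lemma dOmega_shift x y : dOmega d x y =
  1 / 2 * d (x 0%N) (y 0%N) + 1 / 2 * dOmega d (Defs.shift x) (Defs.shift y).
Proof.
have := @cvg_psum x y; rewrite -(cvg_shiftS (psum x y)) => psumS_cvg.
apply: cvg_unique psumS_cvg _ => //; rewrite (funext (psumS x y)).
by apply: cvgD; [exact: cvg_cst|apply: cvgMl_tmp; exact: cvg_psum].
Qed.

Lemma dOmega_ge0 x y : 0 <= dOmega d x y.
Proof. by have := psum_le_dOmega x y 0; rewrite /psum big_geq. Qed.

Lemma dOmegaxx x : dOmega d x x = 0.
Proof.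
apply/eqP; rewrite eq_le dOmega_ge0 andbT; apply: dOmega_le => n.
by rewrite /psum big1// => i _; rewrite d_refl mulr0.
Qed.

Lemma coord_le_dOmega x y n : d (x n) (y n) <= 2 ^+ n.+1 * dOmega d x y.
Proof.
rewrite -ler_pdivrMl ?exprn_gt0//; apply: le_trans (psum_le_dOmega x y n.+1).
rewrite /psum big_nat_recr//= lerDr sumr_ge0// => i _.
by rewrite mulr_ge0// invr_ge0 exprn_ge0.
Qed.

Lemma dOmega_metric : is_metric (dOmega d).
Proof.
have [_ d0 ds tri] := dm; split=> [x y|x y|x y|x y z].
- exact: dOmega_ge0.
- split=> [xy|->]; last exact: dOmegaxx.
  apply/funext => n; apply/d0/eqP; rewrite eq_le d_ge0 andbT.
  by have := coord_le_dOmega x y n; rewrite xy mulr0.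
- rewrite /dOmega; congr (limn _); apply/funext => n.
  by apply: eq_bigr => i _; rewrite ds.
- apply: dOmega_le => n; apply: (@le_trans _ _ (psum x y n + psum y z n)).
    rewrite /psum -big_split/=; apply: ler_sum => i _.
    by rewrite -mulrDr ler_wpM2l// invr_ge0 exprn_ge0.
  by apply: lerD; exact: psum_le_dOmega.
Qed.

Lemma dOmega_pcons a b x y :
  dOmega d (pcons a x) (pcons b y) = 1 / 2 * d a b + 1 / 2 * dOmega d x y.
Proof. by rewrite dOmega_shift. Qed.

Lemma dOmega_pcons_le a x y : dOmega d (pcons a x) (pcons a y) <= dOmega d x y.
Proof. by rewrite dOmega_pcons d_refl; have := dOmega_ge0 x y; lra. Qed.

Lemma dOmega_pword_le n w x y :
  dOmega d (pword n w x) (pword n w y) <= dOmega d x y.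
Proof.
elim: n w => [|n IH] w; first by rewrite !pword0.
rewrite dOmega_shift [pword _ _ _ _]/pword [X in d _ X]/pword /= d_refl.
have := IH (Defs.shift w); have := dOmega_ge0 x y.
by rewrite /Defs.shift /pword; lra.
Qed.

Definition cylinder k (r : R) x : set (nat -> M) :=
  [set y | forall i, (i < k)%N -> d (x i) (y i) < r].

Lemma cylinder_sub_ball (e : R) : 0 < e -> exists k, exists2 r, 0 < r &
  forall x, cylinder k r x `<=` [set y | dOmega d x y < e].
Proof.
have [C C0 dC] := d_bounded; move=> e0.
have [k ek] : exists k, (1 / 2) ^+ k * C < e / 2.
  have : (1 / 2) ^+ k * C @[k --> \oo] --> 0 * C.
    by apply: cvgMr_tmp; apply: cvg_expr; rewrite ger0_norm; lra.
  rewrite mul0r => /cvgrPdist_lt/(_ (e / 2))[|k _ /(_ k (leqnn k))]; first lra.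
  by rewrite sub0r normrN => /(le_lt_trans (ler_norm _)); exists k.
exists k, (e / 2) => [|x y xy]; first lra.
suff : dOmega d x y <= e / 2 + (1 / 2) ^+ k * C by move=> /=; lra.
have r0 : 0 <= e / 2 by lra.
elim: k x y {ek} xy => [|k IH] x y xy.
  apply: (@le_trans _ _ C); last by rewrite expr0 mul1r; lra.
  by apply: dOmega_le => n; exact: psum_le (ltW C0) dC.
rewrite dOmega_shift exprS; have := xy 0%N isT.
have := IH (Defs.shift x) (Defs.shift y) (fun i ik => xy i.+1 ik).
by lra.
Qed.

Local Notation Md := (metrized dm).
Local Notation Omega := (metrized dOmega_metric).

Lemma pcons_continuous x : continuous ((fun a => pcons a x) : Md -> Omega).
Proof.
apply: near_ball_continuous => a e e0; apply/nbhs_ballP; exists e => //= b ab.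
rewrite /ball /= dOmega_pcons dOmegaxx; have := d_ge0 a b.
by move: ab; rewrite /ball /=; lra.
Qed.

Lemma Omega_compact : compact [set: Md] -> compact [set: Omega].
Proof.
move=> Mc; pose id_prod : prod_topology (fun _ : nat => Md) -> Omega := idfun.
suff id_cts : continuous id_prod.
  have -> : [set: Omega] = id_prod @` [set x | forall i, [set: Md] (x i)].
    by apply/seteqP; split=> // x _; exists x.
  apply: (@continuous_compact (prod_topology (fun _ : nat => Md)) Omega
    id_prod).
    exact: continuous_subspaceT.
  exact: (@tychonoff _ (fun _ : nat => Md) (fun=> setT) (fun=> Mc)).
apply: near_ball_continuous => x e e0.
have [k [r r0 xr]] := cylinder_sub_ball e0.
pose close (i : 'I_k) : set (prod_topology (fun _ : nat => Md)) :=
  [set y | ball (x i : Md) r (y i)].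
have close_x i : nbhs x (close i).
  have xir : nbhs (x i : Md) (ball (x i : Md) r) by exact: nbhsx_ballx.
  exact: (@proj_continuous nat (fun=> Md) i x _ xir).
apply: filterS (filter_forall (nbhs_filter x) close_x) => y xy.
by apply: xr => i ik; exact: (xy (Ordinal ik)).
Qed.

End OmegaMetric.

(** * The Ruelle operator *)

Section Ruelle.
Variables (R : realType) (M : pointedType) (d : M -> M -> R).
Variables (dm : is_metric d)
  (mu : probability (g_sigma_algebraType (mopen d)) R).
Variable f : (nat -> M) -> R.
Local Notation Md := (metrized dm).
Hypothesis Mc : compact [set: Md].

Lemma metric_bounded : exists2 C : R, 0 < C & forall a b, d a b <= C.
Proof. exact: compact_mdist_bounded Mc. Qed.

Local Notation Omega := (metrized (dOmega_metric dm metric_bounded)).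
Hypothesis fc : continuous (f : Omega -> R).
Implicit Types (x y z w : Omega) (a : Md) (g h : Omega -> R) (n : nat)
  (c e : R).

Let Omegac : compact [set: Omega] := Omega_compact Mc.

Let M_borel (U : set Md) :
  open U -> measurable ((id : g_sigma_algebraType (mopen d) -> Md) @^-1` U).
Proof. by move=> Uo; apply: sub_sigma_algebra; rewrite (mopenE dm). Qed.

Let integral_pos : positive_functional (fun g : Md -> R => \int[mu]_a g a).
Proof. exact: (Rintegral_positive_functional M_borel Mc mu). Qed.

Let integral_cst c : \int[mu]_a c = c.
Proof.
by rewrite Rintegral_cst// -[RHS]mulr1 [X in fine X](probability_setT mu).
Qed.

Let weight_continuous g : continuous g ->
  continuous (fun x => expR (f x) * g x).
Proof.
move=> gc x; apply: cvgM (gc x).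
apply: (@cvg_comp _ _ _ f expR (nbhs x) (nbhs (f x))); first exact: fc.
exact: continuous_expR.
Qed.

Let integrand_continuous g x : continuous g ->
  continuous (fun a : Md => expR (f (pcons a x)) * g (pcons a x)).
Proof.
move=> gc a; pose weighted y := expR (f y) * g y.
apply: (@continuous_comp Md Omega R (fun b => pcons b x) weighted a).
  exact: pcons_continuous.
exact: weight_continuous.
Qed.

Lemma ruelle_dist g x y e : continuous g ->
  (forall a, `|expR (f (pcons a x)) * g (pcons a x) -
              expR (f (pcons a y)) * g (pcons a y)| <= e) ->
  `|ruelle mu f g x - ruelle mu f g y| <= e.
Proof.
move=> gc gxy; rewrite -[e]mulr1 -(integral_cst 1).
by apply: (positive_functional_dist integral_pos) => //;
  exact: integrand_continuous.
Qed.

Lemma ruelle_positive :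
  positive_operator (ruelle mu f : (Omega -> R) -> Omega -> R).
Proof.
have [I_lin I_ge0] := integral_pos.
split=> [g gc|x].
  apply: near_ball_continuous => x e e0.
  have e20 : 0 < e / 2 by rewrite divr_gt0.
  have /unif_continuousP/(_ _ e20)[/= r r0 gr] :=
    compact_unif_continuous Omegac (weight_continuous gc).
  apply/(@nbhs_ballP R Omega); exists r => // y xy; rewrite /ball /=.
  apply: (@le_lt_trans _ _ (e / 2)); last by rewrite gtr_pMr// invf_lt1 ?ltr1n.
  apply: ruelle_dist => // a; apply/ltW/(gr (pcons a x, pcons a y)) => /=.
  exact: le_lt_trans (dOmega_pcons_le dm metric_bounded a x y) xy.
split=> [c g h gc hc|g gc g0].
  rewrite /ruelle -I_lin;
    [|exact: integrand_continuous|exact: integrand_continuous].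
  by apply: eq_Rintegral => a _; rewrite mulrDr mulrCA.
apply: (I_ge0 _ (@integrand_continuous g x gc)) => a.
by rewrite mulr_ge0// expR_ge0.
Qed.

Lemma ruelle1_gt0 x : 0 < ruelle mu f (fun=> 1) x.
Proof.
have onec : continuous (cst 1 : Omega -> R) by exact: cst_continuous.
have [y|c c0 cw] := compact_continuous_gt0 Omegac (weight_continuous onec).
  by rewrite mulr1 expR_gt0.
rewrite (lt_le_trans c0)// -[leLHS]integral_cst.
have [cc ic] := (@cst_continuous Md R c, @integrand_continuous _ x onec).
exact: (positive_functional_le integral_pos cc ic (fun a => cw (pcons a x))).
Qed.

(* In the induction, [c] and [c'] absorb the weights of the symbols already
   prepended. *)
Lemma iter_ruelle_le n c c' x y g h : continuous g -> continuous h ->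
  (forall w, c * (expR (Ssum f n (pword n w x)) * g (pword n w x)) <=
             c' * (expR (Ssum f n (pword n w y)) * h (pword n w y))) ->
  c * iter n (ruelle mu f) g x <= c' * iter n (ruelle mu f) h y.
Proof.
move=> gc hc; elim: n c c' x y => [|n IH] c c' x y gh.
  by have := gh point; rewrite !pword0 /Ssum !big_ord0 expR0 !mul1r.
have Lnc (k : Omega -> R) z : continuous k ->
    continuous (fun a : Md =>
      expR (f (pcons a z)) * iter n (ruelle mu f) k (pcons a z)).
  move=> kc.
  by apply/integrand_continuous/(positive_operator_iter n ruelle_positive).1.
rewrite !iterS /ruelle -!(positive_functionalZ integral_pos); try exact: Lnc.
apply: (positive_functional_le integral_pos) => [||a].
- exact: (continuous_scale c (Lnc g x gc)).
- exact: (continuous_scale c' (Lnc h y hc)).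
rewrite !mulrA; apply: IH => w.
have := gh (fun k => if (k < n)%N then w k else a).
rewrite -!pword_rcons !SsumS_pword.
have regroup (k s t u : R) : k * (expR (s + t) * u) = k * expR t * (expR s * u).
  by rewrite expRD; ring.
by rewrite (regroup c) (regroup c').
Qed.

Hypothesis fw : weak_walters d f.

Lemma weak_walters_Ssum e : 0 < e -> exists2 r : R, 0 < r &
  forall x y, ball x r y -> forall n w,
    Ssum f n (pword n w x) <= Ssum f n (pword n w y) + e.
Proof.
move=> e0; have [r r0 fr] := fw e0; exists r => // x y /fr xy -[|n] w.
  by rewrite /Ssum !big_ord0 add0r ltW.
rewrite -lerBlDl -lee_fin; apply: le_trans (ltW xy).
by apply: le_trans (lee_abs _); apply: ereal_sup_ubound; exists n.+1, w.
Qed.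

Lemma ruelle_log_equicontinuous :
  log_equicontinuous (ruelle mu f : (Omega -> R) -> Omega -> R).
Proof.
move=> g gc g0 e e0; have [c c0 cg] := compact_continuous_gt0 Omegac gc g0.
pose s := ln (1 + e) / 2.
have s0 : 0 < s by rewrite divr_gt0// ln_gt0// ltrDl.
have [r r0 fr] := weak_walters_Ssum s0.
have cs0 : 0 < c * s by rewrite mulr_gt0.
have /unif_continuousP/(_ _ cs0)[/= t t0 gt] :=
  compact_unif_continuous Omegac gc.
exists (Num.min r t) => [|x y xy n]; first by rewrite lt_min r0.
rewrite -[leLHS]mul1r; apply: iter_ruelle_le => // w; rewrite mul1r.
have -> : 1 + e = expR s * expR s.
  by rewrite -expRD /s -splitr lnK// posrE addr_gt0.
rewrite mulrACA; apply: ler_pM; rewrite ?expR_ge0 ?(ltW (g0 _))//.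
  rewrite -expRD ler_expR addrC; apply: fr; apply: le_ball xy.
  by rewrite ge_min lexx.
have : ball (g (pword n w x)) (c * s) (g (pword n w y)).
  apply: (gt (pword n w x, pword n w y)) => /=.
  apply: le_lt_trans (dOmega_pword_le dm metric_bounded n w x y) _.
  by move: xy; rewrite /ball /= lt_min => /andP[].
rewrite /ball /= ltr_norml => /andP[_ ?]; have cgy := cg (pword n w y).
apply: (@le_trans _ _ ((1 + s) * g (pword n w y))); first by nra.
by rewrite ler_wpM2r ?expR_ge1Dx// ltW.
Qed.

Hypothesis mu_supp : forall U : set M, mopen d U -> U !=set0 -> (0 < mu U)%E.

Let mu_ball r : 0 < r ->
  exists2 c, 0 < c & forall a, c <= fine (mu (ball a r)).
Proof.
apply: (full_support_ball_ge Mc M_borel) => U Uo; apply: mu_supp.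
by rewrite (mopenE dm).
Qed.

(* Each application of the operator frees one coordinate, at the cost of the
   mass of a ball around the corresponding coordinate of the center. *)
Lemma iter_ruelle_cylinder r : 0 < r -> exists2 c, 0 < c &
  forall n x g t, continuous g -> (forall y, 0 <= g y) -> 0 <= t ->
    (forall y, cylinder d n r x y -> t <= g y) ->
  forall y, c ^+ n * t <= iter n (ruelle mu f) g y.
Proof.
move=> r0; have [c c0 cmu] := mu_ball r0.
have [B B0 fB] := compact_continuous_bounded Omegac fc.
have [Lc Lpos] := ruelle_positive.
exists (expR (- B) * c) => [|n]; first by rewrite mulr_gt0// expR_gt0.
elim: n => [|n IH] x g t gc g0 t0 gt y; first by rewrite mul1r; exact: gt.
rewrite iterSr exprSr -mulrA; apply: (IH (Defs.shift x)) => [||| z xz].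
- exact: Lc.
- by move=> z; apply: (Lpos z).2.
- by rewrite !mulr_ge0 ?expR_ge0// ltW.
apply: (@le_trans _ _ (expR (- B) * t * fine (mu (ball (x 0%N : Md) r)))).
  by rewrite mulrAC ler_wpM2l// mulr_ge0// expR_ge0.
apply: Rintegral_ge_indic.
- exact: M_borel (metric_ball_open _ _).
- exact: (continuous_integrable M_borel Mc mu (@integrand_continuous g z gc)).
move=> a; rewrite indicE; have [xa|_] := boolP (a \in _); last first.
  by rewrite mulr0 mulr_ge0// expR_ge0.
rewrite mulr1; apply: ler_pM; rewrite ?expR_ge0//.
  by rewrite ler_expR; have := fB (pcons a z); rewrite ler_norml => /andP[].
by apply: gt => -[|i] /=; [move: xa; rewrite inE|exact: xz].
Qed.

Lemma ruelle_ball_minorized :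
  ball_minorized (ruelle mu f : (Omega -> R) -> Omega -> R).
Proof.
move=> r r0; have [k [s s0 cyl]] := cylinder_sub_ball dm metric_bounded r0.
have [c c0 Lc] := iter_ruelle_cylinder s0.
exists k, (c ^+ k); first exact: exprn_gt0.
by move=> x g t gc g0 t0 gt; apply: (Lc _ x) => // y /cyl; exact: gt.
Qed.

Theorem ruelle_operator_perron_frobenius : exists lam h P,
  perron_frobenius (ruelle mu f : (Omega -> R) -> Omega -> R) lam h P.
Proof.
exact: (ruelle_perron_frobenius Omegac ruelle_positive ruelle1_gt0
  ruelle_log_equicontinuous ruelle_ball_minorized).
Qed.

End Ruelle.

Theorem mainTheorem9 (R : realType) (M : pointedType) (d : M -> M -> R)
  (mu : probability (g_sigma_algebraType (mopen d)) R)
  (f : (nat -> M) -> R) :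
  is_metric d ->
  mcompact d ->
  (forall U : set M, mopen d U -> U !=set0 -> (0 < mu U)%E) ->
  mcontinuous (dOmega d) f ->
  weak_walters d f ->
  exists (lam : R) (h : (nat -> M) -> R)
         (nu : probability (g_sigma_algebraType (mopen (dOmega d))) R),
    [/\ 0 < lam,
        mcontinuous (dOmega d) h /\ (forall x, 0 < h x),
        (forall x, ruelle mu f h x = lam * h x) /\
        (forall phi : (nat -> M) -> R, mcontinuous (dOmega d) phi ->
           Rintegral nu setT (ruelle mu f phi) = lam * Rintegral nu setT phi),
        (forall phi : (nat -> M) -> R, mcontinuous (dOmega d) phi ->
           forall e : R, 0 < e -> \forall n \near \oo,
             (sup_norm (fun x => (lam ^- n * iter n (ruelle mu f) phi x
                                 - h x * Rintegral nu setT phi)%R) <= e%:E)%E) &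
        (forall nu' : probability (g_sigma_algebraType (mopen (dOmega d))) R,
           (forall phi : (nat -> M) -> R, mcontinuous (dOmega d) phi ->
              Rintegral nu' setT (ruelle mu f phi) = lam * Rintegral nu' setT phi) ->
           forall A : set (g_sigma_algebraType (mopen (dOmega d))),
             measurable A -> nu' A = nu A)].
Proof.
move=> dm M_mcompact mu_supp f_mcontinuous f_walters.
have Mc := @mcompact_compact _ _ _ dm M_mcompact.
pose om := dOmega_metric dm (metric_bounded Mc).
have ctsE g := mcontinuousP om g.
have [lam [h [nu [lam0 [hc h0] [Lh Lnu] cvg_iter nu_unique]]]] :=
  ruelle_operator_perron_frobenius (Mc := Mc) ((ctsE f).1 f_mcontinuous)
    f_walters mu_supp.
rewrite (mopenE om); exists lam, h, nu; split=> //.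
- by split=> //; apply/ctsE.
- by split=> // g /ctsE; exact: Lnu.
- move=> g /ctsE gc e e0; have [N gN] := cvg_iter g gc e e0.
  exists N => // n Nn.
  by apply: ge_ereal_sup => _ [x _ <-]; rewrite lee_fin; exact: gN.
- by move=> nu' nu'L; apply: nu_unique => g gc; apply/nu'L/ctsE.
Qed.
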